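(* Let $\Phi$ be the root system, with positive roots $\Phi^+$, of a simple algebraic group $G$ over $\mathbb{C}$ of one of the types $A_n, B_n, C_n, G_2, F_4, E_6$, and let $\mathcal{I} \subset \Phi^+$ be an ideal. Then $$\sum_{S \in \mathcal{W}^{\mathcal{I}}} t^{|S|} = \prod_{i=1}^{k} \left(1 + t + t^2 + \dots + t^{m^{\mathcal{I}}_i}\right),$$ where $\mathcal{W}^{\mathcal{I}}$ is the set of subsets of $\mathcal{I}^c=\Phi^+ - \mathcal{I}$ of Weyl-type for $\mathcal{I}$ and $m^{\mathcal{I}}_1, \dots, m^{\mathcal{I}}_k$ are the ideal exponents of $\mathcal{I}$.
   Context: $G$ is a simple algebraic group over $\mathbb{C}$ with Borel subgroup $B$ and maximal torus $T \subset B$; $\Phi$ is the associated (irreducible) root system, and $\Pi \subset \Phi^+$ are the simple and positive roots determined by $B$. For $\beta = \sum_{\alpha\in\Pi} c_\alpha \alpha \in \Phi$, the height is $\mathrm{ht}(\beta) = \sum_{\alpha \in \Pi} c_\alpha$. An ideal $\mathcal{I}$ of $\Phi^+$ is a subset such that if $\alpha \in \mathcal{I}$, $\beta \in \Phi^+$ and $\alpha+\beta \in \Phi^+$, then $\alpha+\beta \in \mathcal{I}$. Write $\mathcal{I}^c = \Phi^+ - \mathcal{I}$. Ideal exponents: let $\lambda_i = \#\{\alpha \in \mathcal{I}^c \mid \mathrm{ht}(\alpha) = i\}$ for $i\ge 1$. Then $\lambda_1 \ge \lambda_2 \ge \cdots$. Put $k = \lambda_1$ (the number of simple roots in $\mathcal{I}^c$).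 The ideal exponents $m^{\mathcal{I}}_k \ge \dots \ge m^{\mathcal{I}}_1$ are the parts of the dual partition of $(\lambda_i)$, i.e. $m^{\mathcal{I}}_i = \#\{ j \mid \lambda_j \ge k-i+1\}$. Weyl-type subsets: for $S \subset R \subset \Phi^+$, $S$ is $R$-closed if $\alpha, \beta \in S$ and $\alpha+\beta \in R$ imply $\alpha+\beta \in S$. A subset $S \subset \mathcal{I}^c$ is of Weyl-type for $\mathcal{I}$ if both $S$ and $\mathcal{I}^c - S$ are $\mathcal{I}^c$-closed. $\mathcal{W}^{\mathcal{I}}$ is the set of all such $S$. *)

(* Defs.v *)
From HB Require Import structures.
From mathcomp Require Import all_boot all_order all_fingroup all_algebra finmap.

Set Implicit Arguments.
Unset Strict Implicit.
Unset Printing Implicit Defensive.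

Import Order.TTheory GRing.Theory Num.Theory.
Local Open Scope fset_scope.
Local Open Scope ring_scope.

(* Root systems live in a finite-dimensional inner product space (V, form) over
   an archimedean ordered field R, for instance any realType or rat. *)

Section RootSystem.
Variables (R : archiRealFieldType) (V : vectType R) (form : {dot V for idfun}).

Definition cartan_int (b a : V) : R := 2 * form b a / form a a.

Definition reflection (a v : V) : V := v - cartan_int v a *: a.

Record root_system (Phi : {fset V}) : Prop := RootSystem {
  root_span : <<Phi>>%VS = fullv;
  root_neq0 : 0 \notin Phi;
  root_reflection : {in Phi &, forall a b, reflection a b \in Phi};
  root_integral : {in Phi &, forall a b, cartan_int b a \is a Num.int};
  root_reduced : forall (a : V) (c : R),
    a \in Phi -> c *: a \in Phi -> c = 1 \/ c = - 1 }.

Record root_base (Phi : {fset V}) (n : nat) (Pi : n.-tuple V) : Prop := RootBase {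
  base_basis : basis_of fullv Pi;
  base_sub : {subset Pi <= Phi};
  base_sign : forall b, b \in Phi ->
    (forall i, coord Pi i b \is a Num.nat) \/
    (forall i, - coord Pi i b \is a Num.nat) }.

Definition pos_roots (Phi : {fset V}) (n : nat) (Pi : n.-tuple V) : {fset V} :=
  [fset b in Phi | [forall i, 0 <= coord Pi i b]].

Definition height (n : nat) (Pi : n.-tuple V) (b : V) : R :=
  \sum_(i < n) coord Pi i b.

Definition root_ideal (P I : {fset V}) : Prop :=
  I `<=` P /\
  forall a b : V, a \in I -> b \in P -> a + b \in P -> a + b \in I.

Definition height_count (n : nat) (Pi : n.-tuple V) (Ic : {fset V}) (j : nat)
    : nat :=
  #|` [fset a in Ic | height Pi a == j%:R]|.

Definition max_height (n : nat) (Pi : n.-tuple V) (Ic : {fset V}) : nat :=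
  \max_(a <- Ic) Num.truncn (height Pi a).

(* Meaningful for 1 <= i <= height_count Pi Ic 1.  Only j up to the maximal
   height is tested: beyond it height_count vanishes while the threshold
   is at least 1. *)
Definition ideal_exponent (n : nat) (Pi : n.-tuple V) (Ic : {fset V}) (i : nat)
    : nat :=
  count (fun j => height_count Pi Ic 1 - i + 1 <= height_count Pi Ic j)%N
        (iota 1 (max_height Pi Ic)).

Definition closed_in (P S : {fset V}) : bool :=
  all2rel (fun a b => (a + b \in P) ==> (a + b \in S)) S.

Definition weyl_type_sets (Ic : {fset V}) : {fset {fset V}} :=
  [fset S in fpowerset Ic | closed_in Ic S && closed_in Ic (Ic `\` S)].

End RootSystem.

Inductive cartan_type :=
  TypeA of nat | TypeB of nat | TypeC of nat | TypeG2 | TypeF4 | TypeE6.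

Definition rank (X : cartan_type) : nat :=
  match X with
  | TypeA n | TypeB n | TypeC n => n
  | TypeG2 => 2
  | TypeF4 => 4
  | TypeE6 => 6
  end.

(* B_2 and C_2 are both allowed; they are the same root system. *)
Definition admissible (X : cartan_type) : bool :=
  match X with
  | TypeA n => (1 <= n)%N
  | TypeB n | TypeC n => (2 <= n)%N
  | TypeG2 | TypeF4 | TypeE6 => true
  end.

(* Bourbaki's numbering, shifted to start at 0; the entry (i, j) is
   2 (a_i, a_j) / (a_j, a_j).  In particular the last simple root is short in
   type B and long in type C. *)
Definition cartan_entry (X : cartan_type) (i j : nat) : int :=
  let A i j : int :=
    if i == j then 2
    else if (j == i.+1) || (i == j.+1) then - 1 else 0 in
  let table (M : seq (seq int)) : int := nth 0 (nth [::] M i) j in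
  match X with
  | TypeA _ => A i j
  | TypeB n => if (i == n.-2) && (j == n.-1) then - 2 else A i j
  | TypeC n => if (i == n.-1) && (j == n.-2) then - 2 else A i j
  | TypeG2 => table [:: [::  2; -1];
                        [:: -3;  2]]
  | TypeF4 => table [:: [::  2; -1;  0;  0];
                        [:: -1;  2; -2;  0];
                        [::  0; -1;  2; -1];
                        [::  0;  0; -1;  2]]
  | TypeE6 => table [:: [::  2;  0; -1;  0;  0;  0];
                        [::  0;  2;  0; -1;  0;  0];
                        [:: -1;  0;  2; -1;  0;  0];
                        [::  0; -1; -1;  2; -1;  0];
                        [::  0;  0;  0; -1;  2; -1];
                        [::  0;  0;  0;  0; -1;  2]]
  end.

Definition has_cartan_type (R : archiRealFieldType) (V : vectType R)
    (form : {dot V for idfun}) (n : nat) (Pi : n.-tuple V) (X : cartan_type)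
    : Prop :=
  n = rank X /\
  exists s : 'S_n, forall i j : 'I_n,
    cartan_int form (tnth Pi (s i)) (tnth Pi (s j)) = (cartan_entry X i j)%:~R.

(* Main.v *)
Require Import Defs.
From mathcomp Require Import all_boot all_order all_fingroup all_algebra finmap.
From mathcomp Require Import zify ring lra.
Set Implicit Arguments.
Unset Strict Implicit.
Unset Printing Implicit Defensive.
Import Order.TTheory GRing.Theory Num.Theory.
Local Open Scope fset_scope.
Local Open Scope ring_scope.

(** Write Ic for the complement of the ideal and W(A) for the Weyl-type subsets
    of a set of roots A; by definition W(A) only sees which sums of two elements
    of A lie in A.

    In types A, B and C the roots are added one layer at a time.  Let A and U be
    such that some additive functional kappa vanishes on A and is positive on U,
    and suppose that any two elements of U span a plane containing a root of A.
    Let S' in W(A) be cut out by an additive functional f, that is, S' consists of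
    the a in A with f a < 0.  The closure conditions inside these planes force a
    Weyl-type extension of S' to A + U to meet U in an upper set for the order of
    U by the slope - f / kappa.  Conversely an upper set lies above some threshold
    tau, so f + tau * kappa cuts out the extension, which is therefore of Weyl
    type.  Slopes of distinct elements of U are distinct, so U has exactly one
    upper set of each cardinality, and every S' contributes
    t ^ |S'| (1 + t + .. + t ^ |U|).  This is [weyl_gf_extend]; since the
    extensions are cut out by functionals again, it can be iterated.

    Such layers come from reading the Dynkin diagram from one end to the other and,
    in types B and C, back again: this produces vectors E_0, E_1, .. whose
    consecutive differences are simple roots, the positive roots are differences
    E_i - E_j, and layer i, the roots E_i - E_j with j > i, has one root of each
    height 1, 2, ..  ([words_exponents]).  The complement of an ideal contains an
    initial segment of each layer, so the sizes of these segments form the partition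
    dual to the numbers of roots of each height ([prod_ideal_exponent]), which makes
    them the ideal exponents.

    In types F_4 and E_6 the layers are no longer chains, and the identity is
    checked by computation for each ideal, as it is for G_2.  Adding to A a root b
    that is not a summand of any root of the new set changes W(A) in a simple way:
    b must be in when b = x + y with x and y in, and out when both are out
    ([weyl_type_setsU1]).  A depth-first search through the complements of ideals
    carries along, as a binary trie, one set from each complementary pair in W(A)
    ([search_sound]).

    In both parts the positive roots are found from the Cartan matrix alone: a set of
    nonzero vectors with natural coordinates containing the simple roots is the set
    of positive roots as soon as each simple reflection maps it to itself, apart
    from the simple root that it negates ([pos_roots_of_reflection_closed]). *)

(** * Ideal exponents as a dual partition *)

Definition qint (m : nat) : {poly int} := \sum_(0 <= e < m.+1) 'X^e.

Lemma qint0 : qint 0 = 1.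
Proof. by rewrite /qint big_nat1 expr0. Qed.

(** Conjugation of partitions, the parts being numbered from 0. *)
Lemma ltn_count_geq_sorted (s : seq nat) (i j : nat) :
  sorted geq s -> (0 < j)%N -> (i < count (leq j) s)%N = (j <= nth 0 s i)%N.
Proof.
elim: s i => [|x s IHs] i /= srt j_gt0; first by rewrite nth_nil; lia.
have := order_path_min (rev_trans leq_trans) srt.
move=> /allP x_max; have {}IHs k := IHs k (path_sorted srt) j_gt0.
case: (leqP j x) => [jx|xj].
  by case: i => [|i] /=; rewrite ?jx // add1n ltnS IHs.
have -> : count (leq j) s = 0%N.
  by apply/eqP; rewrite -leqn0 leqNgt -has_count; apply/hasPn => y /x_max /=; lia.
case: i => [|i] /=; first by lia.
case: (ltnP i (size s)) => [/(mem_nth 0%N)/x_max /=|]; first lia.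
by move=> /(nth_default 0%N) ->; lia.
Qed.

Lemma count_leq_iota1 (m h : nat) :
  (m <= h)%N -> count (fun j => j <= m)%N (iota 1 h) = m.
Proof.
elim: h => [|h IHh] mh; first by case: m mh.
have -> : iota 1 h.+1 = iota 1 h ++ [:: h.+1] by rewrite -(addn1 h) iotaD add1n addn1.
rewrite count_cat /= addn0.
case: (eqVneq m h.+1) => [->|ne].
  rewrite leqnn (_ : count _ _ = h) ?addn1 //.
  rewrite -[RHS](size_iota 1 h) -[RHS](count_predT).
  by apply: eq_in_count => j; rewrite mem_iota /=; lia.
by rewrite IHh; lia.
Qed.

Section HeightCounts.
Variables (R : archiRealFieldType) (V : vectType R) (n : nat) (Pi : n.-tuple V).

Lemma height_count_gt_max (A : {fset V}) (j : nat) :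
  (max_height Pi A < j)%N -> height_count Pi A j = 0%N.
Proof.
move=> lt_j; apply/eqP; rewrite cardfs_eq0; apply/eqP/fsetP => a.
rewrite !inE /=; apply/negP => /andP[aA /eqP ha].
suff : (j <= max_height Pi A)%N by lia.
rewrite -(natrK (R := R) j) -ha /max_height; exact: leq_bigmax_seq.
Qed.

(** The hypothesis says that the height counts form the partition dual to [ms],
    which may be unsorted and contain zeros: the sizes of the pieces of a
    decomposition into chains starting at height 1 can serve as [ms] directly. *)
Lemma prod_ideal_exponent (A : {fset V}) (ms : seq nat) :
  (forall j, (0 < j)%N -> height_count Pi A j = count (leq j) ms) ->
  \prod_(1 <= i < (height_count Pi A 1).+1)
     \sum_(0 <= e < (ideal_exponent Pi A i).+1) 'X^e
  = \prod_(m <- ms) qint m.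
Proof.
set k := height_count Pi A 1; set h := max_height Pi A => hcE.
have k_perm : perm_eq ms (sort geq ms) by rewrite perm_sym perm_sort.
rewrite (perm_big _ k_perm) /=.
set s := sort geq ms.
have s_sorted : sorted geq s by apply: sort_sorted => x y /=; lia.
have {}hcE j : (0 < j)%N -> height_count Pi A j = count (leq j) s.
  by move=> /hcE ->; apply/seq.permP.
have s_le m : m \in s -> (m <= h)%N.
  case: (posnP m) => [-> //|m_gt0] ms_m; rewrite leqNgt; apply/negP.
  move=> /height_count_gt_max; rewrite hcE // => c0.
  have: (0 < count (leq m) s)%N by rewrite -has_count; apply/hasP; exists m => /=.
  by rewrite c0.
have nthE i j : (0 < j)%N -> (i < height_count Pi A j)%N = (j <= nth 0 s i)%N.
  by move=> j_gt0; rewrite hcE // ltn_count_geq_sorted.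
(* The product runs over the exponents in decreasing order after reversal, so
   that its i-th factor is the i-th entry of the sorted list. *)
rewrite big_nat_rev /= big_add1 /=.
under eq_big_nat => i /andP[_ ik].
  rewrite (_ : \sum_(0 <= e < _) _ = qint (nth 0 s i)%N); last first.
    rewrite /qint; congr (\sum_(0 <= e < _.+1) _).
    rewrite /ideal_exponent -/k -/h.
    have -> : (k - (1 + k.+1 - i.+2) + 1)%N = i.+1 by lia.
    have nth_le : (nth 0 s i <= h)%N.
      case: (ltnP i (size s)) => [/(mem_nth 0%N)/s_le //|/(nth_default 0%N) ->//].
    rewrite -[RHS](count_leq_iota1 nth_le).
    by apply: eq_in_count => j; rewrite mem_iota => /andP[j_gt0 _]; rewrite nthE.
  over.
(* Entries of the sorted list beyond the k-th are zero and contribute 1. *)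
rewrite [RHS](big_nth 0%N) /=.
have k_le : (k <= size s)%N by rewrite /k hcE // count_size.
rewrite [RHS](big_cat_nat _ k_le) //= [X in _ = _ * X]big_nat_cond.
rewrite [X in _ = _ * X]big1 ?mulr1 // => i; rewrite andbT => /andP[ki _].
suff -> : nth 0%N s i = 0%N by exact: qint0.
by move: (nthE i 1%N isT); rewrite -/k; lia.
Qed.

End HeightCounts.

(** * Weyl-type subsets and additive functionals *)

Section WeylType.
Variables (R : archiRealFieldType) (V : vectType R).
Implicit Types (A U S T : {fset V}) (f kappa : V -> R).

Definition weyl_gf A : {poly int} := \sum_(S <- weyl_type_sets A) 'X^(#|` S|).

Lemma closed_inP A S :
  reflect (forall a b, a \in S -> b \in S -> a + b \in A -> a + b \in S)
          (closed_in A S).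
Proof.
apply: (iffP allrelP) => [clS a b aS bS abA|clS a b aS bS].
  by have /implyP := clS a b aS bS; apply.
by apply/implyP; apply: clS.
Qed.

Lemma weyl_typeP A S :
  reflect [/\ S `<=` A,
              forall a b, a \in S -> b \in S -> a + b \in A -> a + b \in S
            & forall a b, a \in A -> b \in A -> a \notin S -> b \notin S ->
                a + b \in A -> a + b \notin S]
          (S \in weyl_type_sets A).
Proof.
rewrite !inE /= fpowersetE; apply: (iffP and3P).
  move=> [SA /closed_inP clS /closed_inP clC]; split=> // a b aA bA aS bS abA.
  by have := clC a b; rewrite !inE aA bA aS bS abA => /(_ isT isT isT) /andP[].
move=> [SA clS clC]; split=> //; apply/closed_inP => // a b.
by rewrite !inE => /andP[aS aA] /andP[bS bA] abA; rewrite abA clC.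
Qed.

Lemma weyl_type_compl A S :
  S \in weyl_type_sets A -> A `\` S \in weyl_type_sets A.
Proof.
move=> /weyl_typeP[SA clS clC]; apply/weyl_typeP; split; first exact: fsubsetDl.
  by move=> a b; rewrite !in_fsetD => /andP[aS aA] /andP[bS bA] abA; rewrite abA clC.
move=> a b aA bA; rewrite !in_fsetD aA bA !andbT !negbK => aS bS abA.
by rewrite abA clS.
Qed.

(** Genericity (no zero of f on A) is part of the notion, so that the complement
    of S in A is the locus f > 0. *)
Definition realised f A S : Prop :=
  [/\ {morph f : x y / x + y}, {in A, forall a, f a != 0}
    & S = [fset a in A | f a < 0]].

Lemma realised_weyl_type f A S : realised f A S -> S \in weyl_type_sets A.
Proof.
move=> [fD f_neq0 ->]; apply/weyl_typeP; split=> [|a b|a b aA bA].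
- by apply/fsubsetP => a; rewrite !inE => /andP[].
- by rewrite !inE /= => /andP[_ a0] /andP[_ b0] ->; rewrite fD; lra.
rewrite !inE aA bA /= -!leNgt => a0 b0 ->; rewrite fD -leNgt.
exact: addr_ge0.
Qed.

Lemma weyl_type_sets0 : weyl_type_sets (fset0 : {fset V}) = [fset fset0].
Proof.
apply/fsetP => S; apply/weyl_typeP/idP.
  by rewrite inE => -[]; rewrite fsubset0.
by rewrite inE => /eqP ->; split.
Qed.

Lemma weyl_gf0 : weyl_gf fset0 = 1.
Proof. by rewrite /weyl_gf weyl_type_sets0 big_seq_fset1 cardfs0 expr0. Qed.

Section UpperSets.
Variables (U : {fset V}) (x : V -> R).
Hypothesis x_inj : {in U &, injective x}.

Definition upper_set T := allrel (fun u v => x v < x u) T (U `\` T).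

(** Density of the ordered field gives a cut between the values of x on T and
    those on its complement. *)
Lemma upper_set_threshold T : T `<=` U -> upper_set T ->
  exists tau, {in U, forall u, x u != tau} /\
              {in U, forall u, (u \in T) = (tau < x u)}.
Proof.
move=> TU /allrelP upT.
have cut (s1 s2 : seq V) : (forall u v, u \in s1 -> v \in s2 -> x v < x u) ->
    exists tau, (forall u, u \in s1 -> tau < x u) /\
                (forall v, v \in s2 -> x v < tau).
  elim: s1 => [_|u s1 IHs lt_s].
    elim: s2 => [|v s2 [tau [_ tauP]]]; first by exists 0.
    exists (Num.max tau (x v + 1)); split=> // w.
    rewrite inE lt_max => /predU1P[->|/tauP -> //].
    by rewrite ltrDl ltr01 orbT.
  have [w v|tau [tau1 tau2]] := IHs.
    by move=> ws; apply: lt_s; rewrite inE ws orbT.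
  case: (ltP tau (x u)) => [tau_u|u_tau].
    by exists tau; split=> // w; rewrite inE => /predU1P[->|/tau1].
  have [sigma [s_u sP]] : exists sigma, sigma < x u /\
      forall v, v \in s2 -> x v < sigma.
    have : forall v, v \in s2 -> x v < x u by move=> v; apply: lt_s; rewrite inE eqxx.
    elim: {tau2 lt_s IHs} s2 => [|v s2 IHs] lt_u.
      by exists (x u - 1); split=> //; lra.
    have [w ws|sigma [s_u sP]] := IHs; first by apply: lt_u; rewrite inE ws orbT.
    have vu : x v < x u by apply: lt_u; rewrite inE eqxx.
    exists (Num.max sigma ((x v + x u) / 2)); split.
      by rewrite gt_max s_u /=; lra.
    move=> w; rewrite inE lt_max => /predU1P[->|/sP -> //].
    by apply/orP; right; lra.
  exists sigma; split=> // w; rewrite inE => /predU1P[-> //|/tau1].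
  by apply: lt_trans; apply: lt_le_trans u_tau.
have [tau [tau1 tau2]] := cut _ _ upT; exists tau; split=> u uU.
  have := tau1 u; have := tau2 u; rewrite inE uU andbT.
  by case: (u \in T) => [_ /(_ isT)|/(_ isT) + _];
    [rewrite lt_neqAle eq_sym|rewrite lt_neqAle] => /andP[].
have := tau1 u; have := tau2 u; rewrite inE uU andbT.
case: (u \in T) => [_ /(_ isT) -> //|/(_ isT) lt_u _].
by apply/esym/negbTE; rewrite -leNgt ltW.
Qed.

(** The upper sets of a chain are its initial segments in decreasing order, one for
    each cardinality. *)
Lemma sum_upper_sets :
  \sum_(T <- fpowerset U | upper_set T) 'X^(#|` T|) = qint #|` U|.
Proof.
pose le_x := fun u v => x v <= x u.
pose us := sort le_x U; have us_U : us =i U by move=> u; rewrite mem_sort.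
have us_uniq : uniq us by rewrite sort_uniq fset_uniq.
have us_sorted : sorted le_x us.
  by apply: sort_sorted => u v; rewrite /le_x le_total.
have le_x_trans : transitive le_x by move=> v u w uv vw; exact: le_trans vw uv.
have us_size : size us = #|` U| by rewrite size_sort.
pose pre j : {fset V} := [fset u in take j us].
have pre_card j : (j <= #|` U|)%N -> #|` pre j| = j.
  move=> jm; rewrite /pre card_fseq undup_id ?take_uniq //.
  by rewrite size_takel ?us_size.
have perm_pre : perm_eq [seq T <- fpowerset U | upper_set T]
                        [seq pre j | j <- iota 0 (#|` U|).+1].
  apply: uniq_perm; first exact/filter_uniq/fset_uniq.
    rewrite map_inj_in_uniq ?iota_uniq // => i j; rewrite !mem_iota /= !add0n !ltnS.
    by move=> iU jU /(congr1 (fun T : {fset V} => #|` T|)); rewrite !pre_card.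
  move=> T; rewrite mem_filter fpowersetE; apply/andP/mapP => [[upT TU]|].
    (* An upper set is the part of the sorted list before its first nonmember. *)
    move/allrelP in upT; pose j := find [pred u | u \notin T] us.
    exists j; first by rewrite mem_iota /= add0n ltnS -us_size find_size.
    have drop_T u : u \in drop j us -> u \notin T.
      move=> u_drop; apply/negP => uT.
      have j_lt : (j < size us)%N.
        by rewrite ltnNge; apply/negP => /drop_oversize dE; rewrite dE in u_drop.
      pose v := nth u us j.
      have vT : v \notin T.
        by have := @nth_find _ u [pred u | u \notin T] us; rewrite has_find; apply.
      have vU : v \in U by rewrite -us_U mem_nth.
      have lt_vu : x v < x u by apply: upT; rewrite // inE vT.
      have : sorted le_x (drop j us) by apply: drop_sorted.
      rewrite (drop_nth u) //= => /(order_path_min le_x_trans)/allP min_v.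
      move: u_drop; rewrite (drop_nth u) // inE => /predU1P[uv|/min_v].
        by move: vT; rewrite /v -uv uT.
      by rewrite /le_x leNgt lt_vu.
    apply/fsetP => u; rewrite !inE /=; apply/idP/idP => [uT|].
      have : u \in us by rewrite us_U (fsubsetP TU).
      by rewrite -{1}(cat_take_drop j us) mem_cat => /orP[//|/drop_T]; rewrite uT.
    move=> u_take; have i_lt : (index u us < j)%N by rewrite index_ltn.
    have := before_find u i_lt; rewrite /= nth_index ?(mem_take u_take) //.
    by move/negbFE.
  move=> [j]; rewrite mem_iota /= add0n ltnS => jU -> {T}; split; last first.
    by apply/fsubsetP => u; rewrite inE /= => /mem_take; rewrite us_U.
  apply/allrelP => u v; rewrite !inE /= => u_take /andP[v_take vU].
  have v_drop : v \in drop j us.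
    by move: vU; rewrite -us_U -{1}(cat_take_drop j us) mem_cat (negPf v_take).
  have uU : u \in U by rewrite -us_U (mem_take u_take).
  rewrite lt_neqAle; apply/andP; split.
    apply/eqP => /x_inj vu; move: v_take; rewrite vu // u_take //.
  move: us_sorted; rewrite -(cat_take_drop j us) sorted_pairwise //.
  by rewrite pairwise_cat => /andP[/allrelP le_td _]; exact: le_td.
rewrite -big_filter (perm_big _ perm_pre) big_map /qint.
rewrite /index_iota subn0; apply: eq_big_seq => j.
by rewrite mem_iota /= add0n ltnS => /pre_card ->.
Qed.

End UpperSets.
End WeylType.

(** * Adding a layer in which any two roots are separated *)

Section Extension.
Variables (R : archiRealFieldType) (V : vectType R).
Implicit Types (A U S T : {fset V}) (f kappa : V -> R).

(** The plane of u and v meets A in the root u - v, up to sign. *)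
Definition linked A (u v : V) := (u - v \in A) || (v - u \in A).

(** The ways in which a root of A separates u and v in the classical types: the
    difference u - v is a root of A up to sign; or, in type B, it is twice such a
    root and w is the midpoint of u and v; or, in type C, one of u, v is the sum of
    the other and w, whose difference is a root of A up to sign. *)
Definition collinear_in A U (u v : V) : Prop :=
  [\/ linked A u v,
      exists2 w, w \in U & u - w = w - v /\ linked A u w,
      exists2 w, w \in U & u = v + w /\ linked A v w
    | exists2 w, w \in U & v = u + w /\ linked A u w].

Variables (A U : {fset V}) (kappa : V -> R).
Hypothesis kappaD : {morph kappa : x y / x + y}.
Hypothesis kappaA : {in A, forall a, kappa a = 0}.
Hypothesis kappaU : {in U, forall u, 0 < kappa u}.
Hypothesis collU : {in U &, forall u v, u != v -> collinear_in A U u v}.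

Lemma kappa_disjoint : [disjoint A & U]%fset.
Proof.
apply/fdisjointP => a aA; apply/negP => /kappaU.
by rewrite kappaA // ltxx.
Qed.

Section Slope.
Variable f : V -> R.
Hypothesis fD : {morph f : x y / x + y}.
Hypothesis f_neq0 : {in A, forall a, f a != 0}.

(** Adding a multiple tau of kappa to f makes u negative exactly when tau is below
    this value, whence the order of U in which extensions of the set f < 0 grow. *)
Definition slope u := - f u / kappa u.

Lemma ltr_slope u v : u \in U -> v \in U ->
  (slope u < slope v) = (f v * kappa u < f u * kappa v).
Proof.
move=> uU vU; rewrite /slope ltr_pdivrMr ?kappaU // mulrAC ltr_pdivlMr ?kappaU //.
by rewrite !mulNr ltrN2.
Qed.

Lemma eqr_slope u v : u \in U -> v \in U ->
  (slope u == slope v) = (f u * kappa v == f v * kappa u).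
Proof.
move=> uU vU; rewrite /slope eqr_div ?lt0r_neq0 ?kappaU //.
by rewrite !mulNr eqr_opp.
Qed.

Lemma morph_subE (g : V -> R) : {morph g : x y / x + y} ->
  forall u v, g (u - v) = g u - g v.
Proof. by move=> gD u v; rewrite -[in RHS](subrK v u) [in RHS]gD addrK. Qed.

Lemma linked_sym u v : linked A u v = linked A v u.
Proof. exact: orbC. Qed.

Lemma linked_kappa u v : linked A u v -> kappa u = kappa v.
Proof.
by case/orP => /kappaA; rewrite morph_subE //; lra.
Qed.

Lemma linked_neq u v : linked A u v -> f u != f v.
Proof.
by case/orP => /f_neq0; rewrite morph_subE // subr_eq0 // eq_sym.
Qed.

(** Equal slopes would make f vanish on the root of A that separates the two. *)
Lemma slope_inj : {in U &, injective slope}.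
Proof.
move=> u v uU vU /eqP; rewrite eqr_slope // => /eqP fuv; apply/eqP.
apply: contraT => /(collU uU vU)[uv|[w wU [uwv uw]]|[w wU [uE vw]]|[w wU [vE uw]]].
- have := linked_neq uv; rewrite (linked_kappa uv) in fuv.
  by move/eqP; case; apply: mulIf fuv; rewrite lt0r_neq0 ?kappaU.
- have wv : linked A w v by move: uw; rewrite /linked uwv -[w - u]opprB uwv opprB.
  have kE := linked_kappa uw; have kE' := linked_kappa wv.
  have := congr1 f uwv; rewrite !morph_subE // => fE.
  have := linked_neq uw; move/eqP; case.
  have : f u = f v by apply: (mulIf (lt0r_neq0 (kappaU uU))); rewrite -fuv kE kE'.
  by move: fE; lra.
- have kE := linked_kappa vw; have := linked_neq vw; move/eqP; case.
  have := kappaU vU; move: fuv; rewrite uE fD kappaD -kE => fuv k_gt0.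
  by apply: (mulIf (lt0r_neq0 k_gt0)); move: fuv; lra.
- have kE := linked_kappa uw; have := linked_neq uw; move/eqP; case.
  have := kappaU uU; move: fuv; rewrite vE fD kappaD -kE => fuv k_gt0.
  by apply: (mulIf (lt0r_neq0 k_gt0)); move: fuv; lra.
Qed.

Lemma weyl_type_restrict S : S \in weyl_type_sets (A `|` U) ->
  S `&` A \in weyl_type_sets A.
Proof.
move=> /weyl_typeP[SAU clS clC]; apply/weyl_typeP; split.
- exact: fsubsetIr.
- move=> a b; rewrite !inE => /andP[aS aA] /andP[bS bA] abA.
  by rewrite abA clS // inE abA.
move=> a b aA bA; rewrite !inE aA bA !andbT => aS bS abA.
by rewrite abA andbT clC // inE ?aA ?bA ?abA.
Qed.

(** If v = u + a with a in A, a larger slope of v means f a < 0, so a is in S and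
    closure of S carries u in S to v in S; if u = v + a then a is outside S, and
    closure of the complement of S gives the same. *)
Lemma linked_slope_mono S u v :
  S \in weyl_type_sets (A `|` U) -> S `&` A = [fset a in A | f a < 0] ->
  u \in U -> v \in U -> linked A u v -> slope u < slope v -> u \in S -> v \in S.
Proof.
move=> /weyl_typeP[SAU clS clC] SA uU vU uv lt_uv uS.
move: lt_uv; rewrite ltr_slope // (linked_kappa uv) ltr_pM2r ?kappaU // => fvu.
have inS a : a \in A -> (a \in S) = (f a < 0).
  by move=> aA; move/fsetP/(_ a): SA; rewrite !inE aA !andbT.
case/orP: uv => [uvA|vuA].
  apply: contraT => vS; suff : v + (u - v) \notin S by rewrite addrC subrK uS.
  apply: clC; rewrite ?inE ?vU ?uvA ?orbT //; last by rewrite addrC subrK uU orbT.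
  by rewrite inS // morph_subE //; lra.
have -> : v = u + (v - u) by rewrite addrC subrK.
apply: clS => //; last by rewrite addrC subrK inE vU orbT.
by rewrite inS // morph_subE //; lra.
Qed.

(** The linked case propagates through the middle element w.  When u = v + w the
    slope of u is the mean of those of v and w, so v and w are compared in
    the same direction as v and u, and closure of S and of its complement does the
    rest. *)
Lemma weyl_type_slope_upper S :
  S \in weyl_type_sets (A `|` U) -> S `&` A = [fset a in A | f a < 0] ->
  {in U &, forall u v, slope u < slope v -> u \in S -> v \in S}.
Proof.
move=> SW SA u v uU vU lt_uv; have mono := linked_slope_mono SW SA.
have /weyl_typeP[SAU clS clC] := SW.
have uv : u != v by apply: contraTneq lt_uv => ->; rewrite ltxx.
have inAU w : w \in U -> w \in A `|` U by move=> wU; rewrite inE wU orbT.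
have [uvl|[w wU [uwv uw]]|[w wU [uE vw]]|[w wU [vE uw]]] := collU uU vU uv.
- exact: mono.
- have wv : linked A w v by move: uw; rewrite /linked uwv -[w - u]opprB uwv opprB.
  have kE := linked_kappa uw; have kE' := linked_kappa wv.
  have := congr1 f uwv; rewrite !morph_subE // => fE.
  move: lt_uv; rewrite ltr_slope // kE kE' ltr_pM2r ?kappaU // => fvu uS.
  apply: (mono w v) => //; first by rewrite ltr_slope // kE' ltr_pM2r ?kappaU //; lra.
  by apply: (mono u w) => //; rewrite ltr_slope // kE kE' ltr_pM2r ?kappaU //; lra.
- have kE := linked_kappa vw; move: lt_uv; rewrite ltr_slope //.
  rewrite {1}uE {1}uE kappaD fD -kE => fvw uS; apply: contraT => vS.
  have fvw' : f v < f w.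
    by rewrite -(ltr_pM2r (kappaU vU)); move: fvw; lra.
  have wS : w \notin S.
    apply: contra vS; apply: mono => //; first by rewrite linked_sym.
    by rewrite ltr_slope // kE ltr_pM2r ?kappaU.
  suff : v + w \notin S by rewrite -uE uS.
  by apply: clC; rewrite -?uE ?inAU.
have kE := linked_kappa uw; move: lt_uv; rewrite ltr_slope //.
rewrite {1}vE {1}vE kappaD fD -kE => fwu uS.
rewrite vE; apply: clS; rewrite -?vE ?inAU //.
apply: (mono u w) => //; rewrite ltr_slope // kE ltr_pM2r ?kappaU //.
by rewrite -(ltr_pM2r (kappaU uU)); move: fwu; lra.
Qed.

(** Since kappa is zero on A, adding tau * kappa to f leaves the part in A as
    it was, and turns negative on U exactly above the threshold. *)
Lemma upper_set_realised T :
  T `<=` U -> upper_set U slope T ->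
  exists g, realised g (A `|` U) ([fset a in A | f a < 0] `|` T).
Proof.
move=> TU upT; have [tau [tau_neq tauP]] := upper_set_threshold TU upT.
have gA a : a \in A -> f a + tau * kappa a = f a.
  by move=> aA; rewrite kappaA // mulr0 addr0.
have gU u : u \in U -> f u + tau * kappa u = (tau - slope u) * kappa u.
  by move=> uU; rewrite /slope; field; rewrite lt0r_neq0 ?kappaU.
exists (fun v => f v + tau * kappa v); split.
- by move=> u v; rewrite fD kappaD; ring.
- move=> a; rewrite inE => /orP[aA|aU]; first by rewrite gA // f_neq0.
  rewrite gU // mulf_neq0 //; last by rewrite lt0r_neq0 ?kappaU.
  by rewrite subr_eq0 eq_sym tau_neq.
apply/fsetP => a; rewrite !inE /=; case: (boolP (a \in U)) => aU.
  have aA : a \notin A by apply: contraL aU; apply/fdisjointP/kappa_disjoint.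
  by rewrite (negPf aA) orbT /= gU // tauP // pmulr_llt0 ?kappaU // subr_lt0.
have -> : a \in T = false by apply: contraNF aU; apply: (fsubsetP TU).
by rewrite !orbF; case: (boolP (a \in A)) => //= aA; rewrite gA.
Qed.

(** Members of the fibre over S' are the sets S' + T for T an upper set of U. *)
Lemma weyl_gf_fiber S' : S' = [fset a in A | f a < 0] ->
  \sum_(S <- weyl_type_sets (A `|` U) | S `&` A == S') 'X^(#|` S|)
  = 'X^(#|` S'|) * qint #|` U|.
Proof.
move=> S'E; have S'A : S' `<=` A.
  by rewrite S'E; apply/fsubsetP => a; rewrite inE => /andP[].
have disj T : T `<=` U -> [disjoint S' & T]%fset.
  move=> TU; apply: fdisjointWl S'A _; apply: fdisjointWr TU _.
  exact: kappa_disjoint.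
have perm_fiber : perm_eq [seq S <- weyl_type_sets (A `|` U) | S `&` A == S']
    [seq S' `|` T | T <- [seq T <- fpowerset U | upper_set U slope T]].
  apply: uniq_perm; first exact/filter_uniq/fset_uniq.
    rewrite map_inj_in_uniq; first exact/filter_uniq/fset_uniq.
    move=> T1 T2; rewrite !mem_filter !fpowersetE => /andP[_ T1U] /andP[_ T2U] TE.
    have : (S' `|` T1) `\` S' = (S' `|` T2) `\` S' by rewrite TE.
    rewrite !fsetDUl !fsetDv !fset0U.
    by rewrite !(fsetDidPl _ _ _) // fdisjoint_sym disj.
  move=> S; rewrite mem_filter; apply/andP/mapP => [[/eqP SA SW]|[T]].
    have SAU : S `<=` A `|` U by case/weyl_typeP: SW.
    exists (S `&` U).
      rewrite mem_filter fpowersetE fsubsetIr andbT; apply/allrelP => u v.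
      rewrite !inE => /andP[uS uU] /andP[]; rewrite negb_and => /orP[vS vU|/negP //].
      rewrite ltNge le_eqVlt; apply/negP => /predU1P[suv|lt_uv].
        by move: vS; rewrite -(slope_inj uU vU suv) uS.
      by move: vS; rewrite (weyl_type_slope_upper SW _ uU vU) // SA.
    by rewrite -SA -fsetIUr; apply/esym/fsetIidPl.
  rewrite mem_filter fpowersetE => /andP[upT TU] -> {S}; split.
    rewrite fsetIUl (fsetIidPl S'A) (_ : T `&` A = fset0) ?fsetU0 //.
    apply/eqP; rewrite fsetI_eq0 fdisjoint_sym; apply: fdisjointWr TU _.
    exact: kappa_disjoint.
  have [g gT] := upper_set_realised TU upT.
  by rewrite S'E; apply: realised_weyl_type gT.
rewrite -big_filter (perm_big _ perm_fiber) big_map big_filter.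
rewrite -(sum_upper_sets slope_inj) big_distrr /= big_seq_cond [RHS]big_seq_cond.
apply: eq_bigr => T; rewrite fpowersetE => /andP[/disj disjT _].
by rewrite cardfsU (eqP disjT) cardfs0 subn0 exprD.
Qed.

End Slope.

(** Realisability by functionals is proved along with the factorisation because
    the next layer needs it of the sets on which it builds. *)
Lemma weyl_gf_extend :
  (forall S, S \in weyl_type_sets A -> exists f, realised f A S) ->
  weyl_gf (A `|` U) = weyl_gf A * qint #|` U| /\
  (forall S, S \in weyl_type_sets (A `|` U) -> exists f, realised f (A `|` U) S).
Proof.
move=> realA; split.
  have W_uniq : uniq (weyl_type_sets A) := fset_uniq _.
  transitivity (\sum_(S <- weyl_type_sets (A `|` U))
     \sum_(S' <- weyl_type_sets A) if S `&` A == S' then 'X^(#|` S|) else 0 : {poly int}).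
    apply: eq_big_seq => S /weyl_type_restrict SA.
    rewrite (bigD1_seq _ SA W_uniq) /= eqxx big1 ?addr0 // => S'.
    by rewrite eq_sym => /negPf ->.
  rewrite exchange_big /= big_distrl /=; apply: eq_big_seq => S' /realA[f [fD f0 SE]].
  by rewrite -big_mkcond /=; apply: (weyl_gf_fiber fD f0 SE).
move=> S SW; have [f [fD f0 SE]] := realA _ (weyl_type_restrict SW).
have SAU : S `<=` A `|` U by case/weyl_typeP: SW.
have [|g gT] := upper_set_realised fD f0 (T := S `&` U) (fsubsetIr _ _).
  apply/allrelP => u v; rewrite !inE => /andP[uS uU] /andP[].
  rewrite negb_and => /orP[vS vU|/negP //].
  rewrite ltNge le_eqVlt; apply/negP => /predU1P[suv|lt_uv].
    by move: vS; rewrite -(slope_inj fD f0 uU vU suv) uS.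
  by move: vS; rewrite (weyl_type_slope_upper fD SW SE uU vU).
exists g; move: gT; rewrite -SE -fsetIUr.
by have /fsetIidPl -> := SAU.
Qed.

End Extension.

(** * Positive roots from simple reflections *)

Section PositiveRoots.
Variables (R : archiRealFieldType) (V : vectType R) (form : {dot V for idfun}).
Variables (Phi : {fset V}) (n : nat) (Pi : n.-tuple V).
Hypothesis rootPhi : root_system form Phi.
Hypothesis basePi : root_base Phi Pi.

Lemma coord_simple i j : coord Pi i (tnth Pi j) = (i == j)%:R.
Proof.
rewrite (tnth_nth 0) coord_free ?(basis_free (base_basis basePi)) //.
by rewrite eq_sym.
Qed.

Lemma coord_expand v : v = \sum_(i < n) coord Pi i v *: tnth Pi i.
Proof.
rewrite {1}(coord_basis (base_basis basePi) (memvf v)).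
by apply: eq_bigr => i _; rewrite (tnth_nth 0).
Qed.

Lemma heightD : {morph height Pi : x y / x + y}.
Proof.
by move=> x y; rewrite /height -big_split; apply: eq_bigr => i _; rewrite linearD.
Qed.

Lemma height_simple i : height Pi (tnth Pi i) = 1.
Proof.
rewrite /height (bigD1 i) //= coord_simple eqxx big1 ?addr0 // => j.
by rewrite coord_simple => /negPf ->.
Qed.

Lemma heightZ c v : height Pi (c *: v) = c * height Pi v.
Proof.
by rewrite /height big_distrr; apply: eq_bigr => i _; rewrite linearZ.
Qed.

Lemma simple_root i : tnth Pi i \in Phi.
Proof. by apply: (base_sub basePi); apply: mem_tnth. Qed.

Lemma root_form_gt0 a : a \in Phi -> 0 < form a a.
Proof.
move=> aPhi; apply: neq0_dnorm_gt0; apply: contraTneq aPhi => ->.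
exact: root_neq0 rootPhi.
Qed.

Lemma cartan_intD a b c :
  cartan_int form (a + b) c = cartan_int form a c + cartan_int form b c.
Proof. by rewrite /cartan_int linearDl; ring. Qed.

Lemma cartan_intZ k a c : cartan_int form (k *: a) c = k * cartan_int form a c.
Proof. by rewrite /cartan_int linearZl_LR /=; ring. Qed.

Lemma cartan_int_self a : a \in Phi -> cartan_int form a a = 2.
Proof.
move=> /root_form_gt0 aa; rewrite /cartan_int mulfK //.
exact: lt0r_neq0.
Qed.

Lemma reflectionD a : {morph reflection form a : u v / u + v}.
Proof. by move=> u v; rewrite /reflection cartan_intD scalerDl opprD addrACA. Qed.

Lemma reflectionZ a k v : reflection form a (k *: v) = k *: reflection form a v.
Proof. by rewrite /reflection cartan_intZ scalerBr scalerA. Qed.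

Lemma reflectionK a : a \in Phi -> involutive (reflection form a).
Proof.
move=> aPhi v; rewrite {1}/reflection; set c := cartan_int form _ a.
have -> : c = - cartan_int form v a.
  by rewrite /c /reflection cartan_intD -scaleNr cartan_intZ cartan_int_self //; ring.
by rewrite /reflection scaleNr opprK subrK.
Qed.

Lemma coord_reflection i j v : j != i ->
  coord Pi j (reflection form (tnth Pi i) v) = coord Pi j v.
Proof.
move=> /negPf ji; rewrite /reflection linearB linearZ /= coord_simple ji.
by rewrite mulr0 subr0.
Qed.

Lemma height_reflection i v : height Pi (reflection form (tnth Pi i) v)
  = height Pi v - cartan_int form v (tnth Pi i).
Proof. by rewrite /reflection -scaleNr heightD heightZ height_simple mulr1. Qed.

(** Otherwise form x x, expanded along the simple roots, would be at most 0. *)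
Lemma exists_positive_cartan_int x :
  (forall i, 0 <= coord Pi i x) -> x != 0 ->
  exists i, 0 < cartan_int form x (tnth Pi i).
Proof.
move=> x_ge0 x_neq0; apply/existsP; apply: contraTT (neq0_dnorm_gt0 (s := form) _ x_neq0).
move=> /existsPn x_le0; rewrite -leNgt.
rewrite {2}(coord_expand x) linear_sum sumr_le0 //= => i _.
rewrite linearZ /= mulr_ge0_le0 //.
have := x_le0 i; rewrite -leNgt /cartan_int.
rewrite pmulr_lle0 ?invr_gt0 ?root_form_gt0 ?simple_root //.
by rewrite pmulr_rle0.
Qed.

Lemma pos_rootsP b :
  reflect (b \in Phi /\ forall i, coord Pi i b \is a Num.nat) (b \in pos_roots Phi Pi).
Proof.
rewrite !inE /=; apply: (iffP andP) => [[bPhi /forallP b_ge0]|[bPhi b_nat]].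
  split=> // i; case: (base_sign basePi bPhi) => // b_nat.
  have /natrP[m bm] := b_nat i; have := b_ge0 i.
  rewrite -oppr_le0 bm lern0 => /eqP m0.
  by rewrite -[coord _ _ _]opprK bm m0 oppr0 rpred0.
by split=> //; apply/forallP => i; have /natrP[m ->] := b_nat i.
Qed.

Lemma pos_root_neq0 b : b \in pos_roots Phi Pi -> b != 0.
Proof.
by case/pos_rootsP => bPhi _; apply: contraTneq bPhi => ->; apply: root_neq0 rootPhi.
Qed.

Lemma height_nat v : (forall i, coord Pi i v \is a Num.nat) ->
  exists m : nat, height Pi v = m%:R.
Proof.
move=> v_nat; apply/natrP; apply: rpred_sum => i _; exact: v_nat.
Qed.

Lemma simple_pos_root i : tnth Pi i \in pos_roots Phi Pi.
Proof.
by apply/pos_rootsP; split=> [|j]; rewrite ?simple_root ?coord_simple ?rpred_nat.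
Qed.

(** A simple reflection changes a single coordinate, and a root other than the
    simple one has a positive coordinate elsewhere, because the system is reduced. *)
Lemma reflection_pos_root i b :
  b \in pos_roots Phi Pi -> b != tnth Pi i ->
  reflection form (tnth Pi i) b \in pos_roots Phi Pi.
Proof.
move=> bP b_neq; have /pos_rootsP[bPhi b_nat] := bP.
have sPhi := root_reflection rootPhi (simple_root i) bPhi.
apply/pos_rootsP; split=> //; case: (base_sign basePi sPhi) => // s_nat.
case: (pickP [pred j | (j != i) && (coord Pi j b != 0)]) => [j /= /andP[ji bj]|b0].
  have /natrP[m mE] := b_nat j; have /natrP[k kE] := s_nat j.
  rewrite coord_reflection // in kE; have : (m + k)%:R = 0 :> R.
    by rewrite natrD -mE -kE addrN.
  move/eqP; rewrite pnatr_eq0 addn_eq0 => /andP[/eqP m0 _].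
  by rewrite mE m0 eqxx in bj.
have bE : b = coord Pi i b *: tnth Pi i.
  rewrite {1}(coord_expand b) (bigD1 i) //= big1 ?addr0 // => j ji.
  by have := b0 j; rewrite /= ji => /negbFE/eqP ->; rewrite scale0r.
have := bPhi; rewrite bE => /(root_reduced rootPhi (simple_root i))[c1|c1].
  by move: b_neq; rewrite bE c1 scale1r eqxx.
by have /natrP[m] := b_nat i; rewrite c1 => m1; have := ler0n R m; rewrite -m1; lra.
Qed.

(** Both inclusions follow by the same descent: a nonzero vector with natural
    coordinates has a positive Cartan integer with some simple root, and the
    corresponding reflection lowers its height; descending ends at a simple
    root, which lies in both sets, and the reflections used are undone on the other
    side. *)
Lemma pos_roots_of_reflection_closed (L : V -> Prop) :
  (forall x, L x -> x != 0 /\ forall i, coord Pi i x \is a Num.nat) ->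
  (forall i, L (tnth Pi i)) ->
  (forall i x, L x -> x != tnth Pi i -> L (reflection form (tnth Pi i) x)) ->
  forall b, b \in pos_roots Phi Pi <-> L b.
Proof.
move=> L_nat L_simple L_refl.
(* Descent inside P, rebuilding inside Q. *)
have descent (P : V -> Prop) :
    (forall x, P x -> x != 0 /\ forall i, coord Pi i x \is a Num.nat) ->
    (forall i x, P x -> x != tnth Pi i -> P (reflection form (tnth Pi i) x)) ->
    forall Q : V -> Prop, (forall i, Q (tnth Pi i)) ->
    (forall i x, Q x -> P (reflection form (tnth Pi i) x) ->
        x != tnth Pi i -> Q (reflection form (tnth Pi i) x)) ->
    forall x, P x -> Q x.
  move=> P_nat P_refl Q Q_simple Q_refl x Px.
  have [m] := height_nat (P_nat x Px).2.
  elim/ltn_ind: m x Px => m IHm x Px hx.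
  have [x0 x_nat] := P_nat x Px.
  have [i ci] : exists i, 0 < cartan_int form x (tnth Pi i).
    by apply: exists_positive_cartan_int => // i; have /natrP[k ->] := x_nat i.
  case: (eqVneq x (tnth Pi i)) => [->//|xi].
  have Psx := P_refl i x Px xi.
  have [k hk] := height_nat (P_nat _ Psx).2.
  have lt_km : (k < m)%N.
    by rewrite -(ltr_nat R) -hk -hx height_reflection; lra.
  have Qsx := IHm k lt_km _ Psx hk.
  rewrite -(reflectionK (simple_root i) x).
  apply: Q_refl; rewrite ?(reflectionK (simple_root i)) //.
  apply: contraTneq ci => /(congr1 (reflection form (tnth Pi i))).
  rewrite (reflectionK (simple_root i)) {1}/reflection => ->.
  rewrite cartan_int_self ?simple_root // -{1}[tnth Pi i]scale1r -scalerBl.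
  by rewrite cartan_intZ cartan_int_self ?simple_root // -leNgt; lra.
have P_nat x : x \in pos_roots Phi Pi ->
    x != 0 /\ forall i, coord Pi i x \is a Num.nat.
  by move=> xP; split; [exact: pos_root_neq0|case/pos_rootsP: xP].
move=> b; split.
  apply: (descent (fun x => x \in pos_roots Phi Pi) P_nat _ L L_simple) => i x.
    exact: reflection_pos_root.
  by move=> Lx _; apply: L_refl.
apply: (descent L L_nat L_refl (fun x => x \in pos_roots Phi Pi)) => i.
  exact: simple_pos_root.
by move=> x xP _; apply: reflection_pos_root.
Qed.

End PositiveRoots.

(** * Ideals of root systems that split into chains *)

Definition exponent_formula (R : archiRealFieldType) (V : vectType R)
    (Phi : {fset V}) (n : nat) (Pi : n.-tuple V) (I : {fset V}) : Prop :=
  let Ic := pos_roots Phi Pi `\` I in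
  let k := height_count Pi Ic 1 in
  \sum_(S <- weyl_type_sets Ic) 'X^(#|` S|) =
  \prod_(1 <= i < k.+1) \sum_(0 <= e < (ideal_exponent Pi Ic i).+1) 'X^e
    :> {poly int}.

Section Coideal.
Variables (R : archiRealFieldType) (V : vectType R).
Variables (Phi : {fset V}) (n : nat) (Pi : n.-tuple V) (I : {fset V}).
Hypothesis idealI : root_ideal (pos_roots Phi Pi) I.
Local Notation P := (pos_roots Phi Pi).
Local Notation Ic := (P `\` I).

Lemma coideal_summand a b : a \in P -> b \in P -> a + b \in Ic -> a \in Ic.
Proof.
move=> aP bP; rewrite !inE => /andP[abI /andP[abPhi ab0]].
move: aP; rewrite !inE => aP; rewrite aP andbT.
apply: contra abI => aI; apply: (idealI.2) => //.
by rewrite !inE abPhi.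
Qed.

End Coideal.

Lemma count_prefix (p : pred nat) (i d : nat) :
  (forall j, (i < j)%N -> (j < i + d)%N -> p j.+1 -> p j) ->
  forall j, (i < j)%N -> (j <= i + d)%N ->
    p j = (j <= i + count p (iota i.+1 d))%N.
Proof.
elim: d i => [|d IHd] i p_down j ij jd; first by lia.
rewrite /=; case: (boolP (p i.+1)) => [pi|npi].
  case: (eqVneq j i.+1) => [->|ne_j]; first by rewrite pi; lia.
  rewrite (IHd i.+1) ?addnA ?addn1 ?addSnnS //; try lia.
  by move=> k ik kd; apply: p_down; lia.
have p0 k : (i < k)%N -> (k <= i + d.+1)%N -> p k = false.
  elim: k => [//|k IHk] ik kd; apply/negP => pk.
  case: (eqVneq k i) => [ki|ne_k]; first by rewrite -ki pk in npi.
  by move: (p_down k); rewrite IHk ?pk; try lia; move=> /(_ _ _ isT); lia.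
have -> : count p (iota i.+2 d) = 0%N.
  apply/eqP; rewrite -leqn0 leqNgt -has_count; apply/hasPn => k.
  by rewrite mem_iota => /andP[ik kd]; rewrite p0 //; lia.
by rewrite p0 //; lia.
Qed.

Lemma collinear_sym (R : archiRealFieldType) (V : vectType R) (A U : {fset V}) u v :
  collinear_in A U u v -> collinear_in A U v u.
Proof.
case=> [uv|[w wU [uwv uw]]|[w wU [uE vw]]|[w wU [vE uw]]].
- by apply: Or41; rewrite linked_sym.
- apply: Or42; exists w => //; split; first by rewrite -opprB -uwv opprB.
  by move: uw; rewrite /linked uwv -[w - u]opprB uwv opprB orbC.
- by apply: Or44; exists w.
by apply: Or43; exists w.
Qed.

Section Layers.
Variables (R : archiRealFieldType) (V : vectType R).
Variables (Phi : {fset V}) (n : nat) (Pi : n.-tuple V) (I : {fset V}).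
Hypothesis idealI : root_ideal (pos_roots Phi Pi) I.
Local Notation P := (pos_roots Phi Pi).
Local Notation Ic := (P `\` I).

(** Layer i consists of the roots E i - E j for i < j <= top i; only the first
    N layers are used.  The functional kappa i vanishes on the layers after i
    and is positive on layer i. *)
Variables (N : nat) (E : nat -> V) (top : nat -> nat) (kappa : nat -> V -> R).

Definition in_layers k (x : V) : Prop :=
  exists i j, [/\ (k <= i < N)%N, (i < j <= top i)%N & x = E i - E j].

Hypothesis posE : forall x, x \in P <-> in_layers 0 x.
Hypothesis heightE : forall i j, (i < N)%N -> (i < j <= top i)%N ->
  height Pi (E i - E j) = (j - i)%:R.
Hypothesis stepE : forall i j, (i < N)%N -> (i < j < top i)%N -> E j - E j.+1 \in P.
Hypothesis kappaD : forall i, {morph kappa i : x y / x + y}.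
Hypothesis kappa0 : forall i x, (i < N)%N -> in_layers i.+1 x -> kappa i x = 0.
Hypothesis kappa_gt0 : forall i j, (i < N)%N -> (i < j <= top i)%N ->
  0 < kappa i (E i - E j).
Hypothesis collE : forall i j j', (i < N)%N -> (i < j < j')%N -> (j' <= top i)%N ->
  [\/ in_layers i.+1 (E j - E j'),
      exists w, [/\ (i < w <= top i)%N, E j - E w = E w - E j'
                  & in_layers i.+1 (E j - E w)]
    | exists w, [/\ (i < w <= top i)%N, E i - E j' = (E i - E j) + (E i - E w)
                  & in_layers i.+1 (E j - E w) \/ in_layers i.+1 (E w - E j)]].

Definition layer_size i := count (fun j => E i - E j \in Ic) (iota i.+1 (top i - i)).

Lemma in_layersW k x : in_layers k x -> x \in P.
Proof.
by move=> [i [j [/andP[_ iN] ij ->]]]; apply/posE; exists i, j; split.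
Qed.

(** The roots of layer i outside the ideal form an initial segment: without its last
    step E j - E j.+1, a positive root, a root outside the ideal is still outside. *)
Lemma layer_memP i j : (i < N)%N -> (i < j <= top i)%N ->
  (E i - E j \in Ic) = (j <= i + layer_size i)%N.
Proof.
move=> iN /andP[ij jt].
apply: (count_prefix (p := fun j => E i - E j \in Ic)) => //; last by lia.
move=> k ik kt kS; have iP m : (i < m <= top i)%N -> E i - E m \in P.
  by move=> im; apply/posE; exists i, m; split.
have kP := stepE iN (j := k); apply: (coideal_summand idealI (b := E k - E k.+1)).
- by apply: iP; lia.
- by apply: kP; lia.
by rewrite addrA subrK.
Qed.

Lemma layer_size_le i : (layer_size i <= top i - i)%N.
Proof. by rewrite -[X in (_ <= X)%N](size_iota i.+1) count_size. Qed.

Definition layer i : {fset V} :=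
  [fset x in [seq E i - E j | j <- iota i.+1 (layer_size i)]].

Lemma layerP i x : (i < N)%N ->
  reflect (exists j, [/\ (i < j <= top i)%N, x = E i - E j & x \in Ic])
          (x \in layer i).
Proof.
move=> iN; have sz := layer_size_le i.
apply: (iffP idP) => [|[j [ij -> jIc]]]; rewrite in_fset; [move=> /mapP[j]|apply/mapP].
  rewrite mem_iota => ij ->; exists j.
  have ij' : (i < j <= top i)%N by lia.
  by split=> //; rewrite layer_memP //; lia.
exists j => //; rewrite mem_iota.
by move: jIc; rewrite layer_memP //; lia.
Qed.

Lemma natr_inj_R (a b : nat) : a%:R = b%:R :> R -> a = b.
Proof. by move/eqP; rewrite eqr_nat => /eqP. Qed.

Lemma card_layer i : (i < N)%N -> #|` layer i| = layer_size i.
Proof.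
move=> iN; have sz := layer_size_le i.
rewrite card_fseq undup_id ?size_map ?size_iota // map_inj_in_uniq ?iota_uniq //.
move=> j j'; rewrite !mem_iota => ij ij' EE.
have : (j - i)%N = (j' - i)%N by apply: natr_inj_R; rewrite -!heightE ?EE //; lia.
by lia.
Qed.

(** The last d layers, outside the ideal: the recursion adds layers from the last to
    the first, as kappa i has to vanish on what is already there. *)
Fixpoint layers_from d : {fset V} :=
  if d is d'.+1 then layers_from d' `|` layer (N - d) else fset0.

Lemma layers_fromP d x : (d <= N)%N ->
  (x \in layers_from d) <-> in_layers (N - d) x /\ x \in Ic.
Proof.
elim: d x => [|d IHd] x dN.
  by split=> [//|[[i [j [/andP[iN]]]]]]; lia.
rewrite /= inE; have dN' : (N - d.+1 < N)%N by lia.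
have le_d : (d <= N)%N by lia.
split=> [/orP[/(IHd x le_d)[[i [j [iN ij xE]]] xIc]|/(layerP x dN')[j [ij xE xIc]]]|].
- by split=> //; exists i, j; split=> //; lia.
- by split=> //; exists (N - d.+1)%N, j; split=> //; lia.
move=> [[i [j [iN ij xE]]] xIc]; apply/orP.
case: (eqVneq i (N - d.+1)%N) => [i_d|ne_i].
  by right; apply/layerP => //; exists j; rewrite -i_d; split.
by left; apply/IHd => //; split=> //; exists i, j; split=> //; lia.
Qed.

Lemma weyl_gf_layers d : (d <= N)%N ->
  weyl_gf (layers_from d) = \prod_(N - d <= i < N) qint (layer_size i) /\
  forall S, S \in weyl_type_sets (layers_from d) ->
    exists f, realised f (layers_from d) S.
Proof.
elim: d => [|d IHd] dN.
  rewrite subn0 big_geq // weyl_gf0; split=> // S; rewrite weyl_type_sets0 inE => /eqP ->.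
  exists (fun=> 0); split=> //; first by move=> x y; rewrite addr0.
  by apply/fsetP => a; rewrite !inE.
have [|gfE realE] := IHd; first by lia.
set i := (N - d.+1)%N; have iN : (i < N)%N by lia.
have iS : i.+1 = (N - d)%N by lia.
have tailP x : in_layers i.+1 x -> x \in Ic -> x \in layers_from d.
  by move=> xl xIc; apply/layers_fromP; [lia|rewrite -iS].
rewrite [layers_from _]/= -/i; set A := layers_from d in gfE realE tailP *.
have kA : {in A, forall a, kappa i a = 0}.
  by move=> a /layers_fromP[|]; [lia|rewrite -iS => al _; exact: kappa0].
have kU : {in layer i, forall u, 0 < kappa i u}.
  by move=> u /(layerP _ iN)[j [ij -> _]]; apply: kappa_gt0.
have inP j : (i < j <= top i)%N -> E i - E j \in P.
  by move=> ij; apply/posE; exists i, j; split.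
(* The separating roots and middle elements given for the whole layer are
   summands of roots outside the ideal, hence outside the ideal themselves. *)
have coll0 j j' : (i < j < j')%N -> (j' <= top i)%N ->
    E i - E j \in Ic -> E i - E j' \in Ic ->
    collinear_in A (layer i) (E i - E j) (E i - E j').
  move=> jj' j't jIc j'Ic; have subE a b : E i - E b - (E i - E a) = E a - E b.
    by rewrite opprB addrC addrA subrK.
  have diff_tail a b : (i < a <= top i)%N -> in_layers i.+1 (E a - E b) ->
      E i - E b \in Ic -> E a - E b \in A.
    move=> ia ab bIc; apply: tailP => //.
    apply: (coideal_summand idealI (b := E i - E a)); [exact: in_layersW ab|exact: inP|].
    by rewrite addrC addrA subrK.
  have [ab|[w [iw wE jw]]|[w [iw wE jw]]] := collE iN jj' j't.
  - by apply: Or41; rewrite /linked !subE (diff_tail _ _ _ ab) ?orbT //; lia.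
  - have wP := inP _ iw; have jwP := in_layersW jw.
    have wIc : E i - E w \in Ic.
      apply: (coideal_summand idealI wP jwP).
      by rewrite wE addrA subrK.
    apply: Or42; exists (E i - E w); first by apply/layerP => //; exists w; split.
    rewrite /linked !subE (diff_tail _ _ _ jw) ?orbT //; last by lia.
    by rewrite -[E w - E j]opprB wE opprB.
  have wIc : E i - E w \in Ic.
    apply: (coideal_summand idealI (b := E i - E j)); rewrite ?inP //; first by lia.
    by rewrite addrC -wE.
  apply: Or44; exists (E i - E w); first by apply/layerP => //; exists w; split.
  split=> //; rewrite /linked !subE; case: jw => jw.
    by rewrite (diff_tail _ _ _ jw) ?orbT //; lia.
  by rewrite (diff_tail _ _ _ jw) //.
have collU : {in layer i &, forall u v, u != v -> collinear_in A (layer i) u v}.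
  move=> u v /(layerP _ iN)[j [ij -> jIc]] /(layerP _ iN)[j' [ij' -> j'Ic]].
  case: (ltngtP j j') => [jj'|jj'|->] ne; last by rewrite eqxx in ne.
    by apply: coll0 => //; lia.
  by apply: collinear_sym; apply: coll0 => //; lia.
have [-> real'] := weyl_gf_extend (kappaD i) kA kU collU realE.
split=> //; rewrite gfE card_layer // [RHS]big_ltn // -iS mulrC; congr (_ * _).
Qed.

Lemma layers_fromE : layers_from N = Ic.
Proof.
apply/fsetP => x; apply/idP/idP => [/layers_fromP[]//|xIc].
apply/layers_fromP => //; split=> //; rewrite subnn; apply/posE.
by move: xIc; rewrite !inE => /andP[].
Qed.

(** Layer i has a single root of height j, namely E i - E (i + j). *)
Lemma height_count_layers j : (0 < j)%N ->
  height_count Pi Ic j = count (leq j) [seq layer_size i | i <- iota 0 N].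
Proof.
move=> j_gt0; pose s := [seq i <- iota 0 N | (j <= layer_size i)%N].
have sP i : i \in s -> [/\ (i < N)%N, (j <= layer_size i)%N & (i < i + j <= top i)%N].
  rewrite mem_filter mem_iota => /andP[ji iN]; have sz := layer_size_le i.
  by split=> //; lia.
have -> : count (leq j) [seq layer_size i | i <- iota 0 N] = size s.
  by rewrite count_map size_filter.
have s_uniq : uniq s by rewrite filter_uniq ?iota_uniq.
have inj_s : {in s &, injective (fun i => E i - E (i + j)%N)}.
  have key i i' : i \in s -> i' \in s -> (i < i')%N ->
      E i - E (i + j)%N <> E i' - E (i' + j)%N.
    move=> /sP[iN _ ij] /sP[i'N _ ij'] ii' EE; have := kappa_gt0 iN ij.
    by rewrite EE kappa0 ?ltxx //; exists i', (i' + j)%N; split; rewrite ?ii' ?i'N.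
  move=> i i' iS i'S EE; case: (ltngtP i i') => // ii'; first by case: (key i i').
  by case: (key i' i).
pose hs := [seq E i - E (i + j)%N | i <- s].
have hs_uniq : uniq hs by rewrite map_inj_in_uniq.
rewrite -(size_map (fun i => E i - E (i + j)%N)) -/hs -(undup_id hs_uniq) -card_fseq.
rewrite /height_count; congr #|` _|; apply/fsetP => x; rewrite !inE /=.
apply/idP/mapP => [/andP[xIc /eqP hx]|[i /sP[iN ji ij] ->]].
  have : x \in Ic by rewrite !inE.
  rewrite -layers_fromE => /layers_fromP[]// [i [j' [iN ij' xE]]] xIc'.
  move: hx; rewrite xE heightE; try lia.
  move=> /natr_inj_R hj; exists i; last by congr (_ - E _); lia.
  rewrite mem_filter mem_iota; move: xIc'; rewrite xE layer_memP //; lia.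
rewrite heightE // addKn eqxx andbT.
by have := layer_memP iN ij; rewrite !inE => ->; rewrite leq_add2l.
Qed.

Lemma layered_exponents : exponent_formula Phi Pi I.
Proof.
rewrite /exponent_formula /= (prod_ideal_exponent height_count_layers) big_map.
rewrite -[LHS]/(weyl_gf Ic) -layers_fromE (weyl_gf_layers (leqnn N)).1 subnn.
by rewrite /index_iota subn0.
Qed.

End Layers.

(** * Positive roots as differences along a word in the simple roots *)

Section SimpleRoots.
Variables (R : archiRealFieldType) (V : vectType R) (form : {dot V for idfun}).
Variables (Phi : {fset V}) (n : nat) (Pi : n.-tuple V) (s : 'S_n).
Hypothesis rootPhi : root_system form Phi.
Hypothesis basePi : root_base Phi Pi.
Variable entry : nat -> nat -> int.
Hypothesis cartanE : forall i j : 'I_n,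
  cartan_int form (tnth Pi (s i)) (tnth Pi (s j)) = (entry i j)%:~R.

(** Simple roots and coordinates in the numbering of the Cartan matrix, extended by
    zero to all natural indices so that index arithmetic stays in nat. *)
Definition simple (k : nat) : V := oapp (fun i => tnth Pi (s i)) 0 (insub k).
Definition scoord (k : nat) (v : V) : R := oapp (fun i => coord Pi (s i) v) 0 (insub k).

Lemma simpleE (i : 'I_n) : simple i = tnth Pi (s i).
Proof. by rewrite /simple valK. Qed.

Lemma scoordE (i : 'I_n) v : scoord i v = coord Pi (s i) v.
Proof. by rewrite /scoord valK. Qed.

Lemma scoordD k : {morph scoord k : x y / x + y}.
Proof.
move=> x y; rewrite /scoord; case: insubP => [i _ _|_] /=; last by rewrite addr0.
exact: linearD.
Qed.

Lemma scoord_simple i k : (k < n)%N -> scoord i (simple k) = (i == k)%:R.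
Proof.
move=> kn; rewrite -[k]/(val (Ordinal kn)) simpleE.
rewrite /scoord; case: insubP => [j _ <-|] /=.
  by rewrite (coord_simple basePi) (inj_eq perm_inj).
by rewrite -leqNgt; case: eqP => // ->; rewrite leqNgt kn.
Qed.

Lemma tnth_simple (i : 'I_n) : tnth Pi i = simple ((s^-1)%g i).
Proof. by rewrite simpleE permKV. Qed.

Lemma height_simple_nat k : (k < n)%N -> height Pi (simple k) = 1.
Proof.
by move=> kn; rewrite -[k]/(val (Ordinal kn)) simpleE (height_simple basePi).
Qed.

Lemma reflection_simple k l : (k < n)%N -> (l < n)%N ->
  reflection form (simple k) (simple l) = simple l - (entry l k)%:~R *: simple k.
Proof.
move=> kn ln; rewrite -[k]/(val (Ordinal kn)) -[l]/(val (Ordinal ln)) !simpleE.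
by rewrite /reflection cartanE.
Qed.

(** The word [phi] of length [D] spells the steps E j - E j.+1 of the sequence E.
    The roots are the E a - E b for the pairs a < b accepted by [good], and the
    reflection in the k-th simple root permutes the indices by [pi k]; in type A
    this is the transposition of k and k + 1, in types B and C the corresponding
    signed permutation. *)
Section Words.
Variables (D : nat) (phi : nat -> nat).
Hypothesis phi_lt : forall j, (j < D)%N -> (phi j < n)%N.

Definition tail_sum (j : nat) : V := \sum_(j <= k < D) simple (phi k).
Local Notation E := tail_sum.

Lemma tail_sumS j : (j < D)%N -> E j = simple (phi j) + E j.+1.
Proof. by move=> jD; rewrite /E big_ltn. Qed.

Lemma tail_sumB a b : (a <= b)%N -> (b <= D)%N ->
  E a - E b = \sum_(a <= k < b) simple (phi k).
Proof. by move=> ab bD; rewrite /E (big_cat_nat ab bD) /= addrK. Qed.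

Lemma scoord_tail_sumB i a b : (a <= b)%N -> (b <= D)%N ->
  scoord i (E a - E b) = (\sum_(a <= k < b) (i == phi k))%:R.
Proof.
move=> ab bD; rewrite tail_sumB // natr_sum.
rewrite (big_morph (scoord i) (scoordD i) (id1 := 0)); last first.
  by rewrite /scoord; case: insub => //= j; rewrite linear0.
apply: eq_big_nat => k /andP[_ kb]; rewrite scoord_simple //.
by apply: phi_lt; lia.
Qed.

Lemma height_tail_sumB a b : (a <= b)%N -> (b <= D)%N ->
  height Pi (E a - E b) = (b - a)%:R.
Proof.
move=> ab bD; rewrite tail_sumB //.
rewrite (big_morph (height Pi) (heightD Pi) (id1 := 0)); last first.
  by rewrite /height big1 // => i _; rewrite linear0.
rewrite (eq_big_nat _ _ (F2 := fun=> 1)) => [|k /andP[_ kb]]; last first.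
  by apply: height_simple_nat; apply: phi_lt; lia.
by rewrite big_const_nat iter_addr_0.
Qed.

Variables (good : nat -> nat -> bool) (pi : nat -> nat -> nat).
Hypothesis good_simple : forall k, (k < n)%N ->
  exists j, [/\ (j < D)%N, phi j = k & good j j.+1].
Hypothesis pi_reflection : forall k j, (k < n)%N -> (j < D)%N ->
  reflection form (simple k) (simple (phi j)) = E (pi k j) - E (pi k j.+1).
Hypothesis pi_good : forall k a b, (k < n)%N -> (a < b <= D)%N -> good a b ->
  (b = a.+1 /\ phi a = k) \/ ((pi k a < pi k b <= D)%N /\ good (pi k a) (pi k b)).

(** Knowing the reflection on the individual steps suffices: the sum over the steps
    from a to b telescopes. *)
Lemma reflection_tail_sumB k a b : (k < n)%N -> (a <= b <= D)%N ->
  reflection form (simple k) (E a - E b) = E (pi k a) - E (pi k b).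
Proof.
move=> kn /andP[ab bD]; rewrite tail_sumB //.
rewrite (big_morph (reflection form (simple k)) (reflectionD form (simple k))
  (id1 := 0)); last first.
  by rewrite -(scale0r (0 : V)) reflectionZ !scale0r.
rewrite -[RHS]opprB -(telescope_sumr (fun j => E (pi k j)) ab) -sumrN.
apply: eq_big_nat => j /andP[_ jb]; rewrite opprB pi_reflection //.
by lia.
Qed.

Lemma pos_roots_words x : x \in pos_roots Phi Pi <->
  exists a b, [/\ (a < b <= D)%N, good a b & x = E a - E b].
Proof.
move: x; apply: (pos_roots_of_reflection_closed rootPhi basePi).
- move=> x [a [b [ab _ ->]]]; have [aLb bD] : (a <= b)%N /\ (b <= D)%N by lia.
  split.
    apply/eqP => /(congr1 (height Pi)); rewrite height_tail_sumB //.
    rewrite /height big1 => [/eqP|i _]; last by rewrite linear0.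
    by rewrite pnatr_eq0; lia.
  move=> i; have := scoord_tail_sumB ((s^-1)%g i) aLb bD.
  by rewrite scoordE permKV => ->; rewrite rpred_nat.
- move=> i; have [|j [jD phij gj]] := good_simple (k := (s^-1)%g i); first exact: ltn_ord.
  exists j, j.+1; split=> //; first by lia.
  by rewrite (tail_sumS jD) addrK phij -tnth_simple.
move=> i x [a [b [ab gab ->]]]; rewrite tnth_simple => x_neq.
have kn : ((s^-1)%g i < n)%N := ltn_ord _.
case: (pi_good kn ab gab) => [[bE phia]|[ab' gab']].
  by case/eqP: x_neq; rewrite bE tail_sumS ?addrK ?phia //; lia.
rewrite reflection_tail_sumB //; last by lia.
by exists (pi ((s^-1)%g i) a), (pi ((s^-1)%g i) b).
Qed.

Variables (I : {fset V}) (top : nat -> nat).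
Hypothesis idealI : root_ideal (pos_roots Phi Pi) I.
Hypothesis top_le : forall i j, (i < n)%N -> (i < j <= top i)%N -> (j <= D)%N /\ good i j.
Hypothesis good_normal : forall a b, (a < b <= D)%N -> good a b ->
  exists i j, [/\ (i < n)%N, (i < j <= top i)%N & E a - E b = E i - E j].
Hypothesis phi_id : forall i, (i < n)%N -> phi i = i.
Hypothesis phi_layer : forall i i' l,
  (i < i' < n)%N -> (i' <= l < top i')%N -> phi l <> i.
Hypothesis collE : forall i j j', (i < n)%N -> (i < j < j')%N -> (j' <= top i)%N ->
  [\/ in_layers n E top i.+1 (E j - E j'),
      exists w, [/\ (i < w <= top i)%N, E j - E w = E w - E j'
                  & in_layers n E top i.+1 (E j - E w)]
    | exists w, [/\ (i < w <= top i)%N, E i - E j' = (E i - E j) + (E i - E w)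
                  & in_layers n E top i.+1 (E j - E w) \/
                    in_layers n E top i.+1 (E w - E j)]].

Lemma words_exponents : exponent_formula Phi Pi I.
Proof.
apply: (@layered_exponents R V Phi n Pi I idealI n E top scoord) => //.
- move=> x; rewrite pos_roots_words; split.
    move=> [a [b [ab gab ->]]]; have [i [j [iN ij abE]]] := good_normal ab gab.
    by exists i, j.
  move=> [i [j [iN ij ->]]]; have [jD gij] := top_le iN ij.
  by exists i, j; split=> //; lia.
- move=> i j iN ij; have [jD _] := top_le iN ij.
  by rewrite height_tail_sumB //; lia.
- move=> i j iN ij; have [|jD _] := top_le (j := j.+1) iN; first by lia.
  rewrite tail_sumS // addrK -[phi j]/(val (Ordinal (phi_lt jD))) simpleE.
  exact: (simple_pos_root basePi).
- exact: scoordD.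
- move=> i x iN [i' [j [i'N ij ->]]]; have [||jD _] := top_le (i := i') (j := j); try lia.
  rewrite scoord_tail_sumB //; last by lia.
  rewrite big_nat_cond big1 // => l; rewrite andbT => il.
  by apply/eqP; rewrite eqb0; apply/eqP => /esym; apply: (phi_layer (i' := i')); lia.
move=> i j iN ij; have [jD _] := top_le iN ij.
rewrite scoord_tail_sumB //; last by lia.
by rewrite big_ltn ?phi_id ?eqxx ?ltr0n //; lia.
Qed.

End Words.
End SimpleRoots.

(** * Types A, B and C *)

Section Classical.
Variables (R : archiRealFieldType) (V : vectType R) (form : {dot V for idfun}).
Variables (Phi : {fset V}) (n : nat) (Pi : n.-tuple V) (s : 'S_n) (I : {fset V}).
Hypothesis rootPhi : root_system form Phi.
Hypothesis basePi : root_base Phi Pi.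
Hypothesis idealI : root_ideal (pos_roots Phi Pi) I.

Lemma subr_scale2 (x : V) : x - 2%:~R *: x = - x.
Proof. by rewrite -[X in X - _]scale1r -scalerBl -scaleN1r; congr (_ *: _); lra. Qed.

Lemma subr_scale0 (x y : V) : x - 0%:~R *: y = x.
Proof. by rewrite scale0r subr0. Qed.

Lemma subr_scaleN1 (x y : V) : x - (- 1)%:~R *: y = x + y.
Proof. by rewrite scaleN1r opprK. Qed.

Lemma subr_scaleN2 (x y : V) : x - (- 2)%:~R *: y = x + y + y.
Proof.
rewrite -addrA -[y in y + y]scale1r -scalerDl -scaleNr; congr (_ + _ *: _).
by rewrite mulrNz opprK.
Qed.

Definition subr_scale := (subr_scale2, subr_scale0, subr_scaleN1, subr_scaleN2).

Section TailSums.
Variables (D : nat) (phi : nat -> nat).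
Local Notation E := (tail_sum Pi s D phi).
Local Notation simple k := (simple Pi s k).

Lemma tail_sumB1 a : (a < D)%N -> E a - E a.+1 = simple (phi a).
Proof. by move=> aD; rewrite tail_sumS // addrK. Qed.

Lemma tail_sumB1N a : (a < D)%N -> E a.+1 - E a = - simple (phi a).
Proof. by move=> aD; rewrite -opprB tail_sumB1. Qed.

Lemma tail_sumB2 a : (a.+1 < D)%N -> E a - E a.+2 = simple (phi a) + simple (phi a.+1).
Proof. by move=> aD; rewrite tail_sumS 1?tail_sumS ?addrA ?addrK //; lia. Qed.

Lemma tail_sumB3 a : (a.+2 < D)%N ->
  E a - E a.+3 = simple (phi a) + simple (phi a.+1) + simple (phi a.+2).
Proof.
by move=> aD; rewrite tail_sumS 1?tail_sumS 1?tail_sumS ?addrA ?addrK //; lia.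
Qed.

(** A palindromic word makes E (D - a) the opposite of E a, up to a constant. *)
Hypothesis phi_mirror : forall j, (j < D)%N -> phi (D - j.+1)%N = phi j.

Lemma tail_sum_opp a : (a <= D)%N -> E (D - a)%N = E 0%N - E a.
Proof.
elim: a => [|a IHa] aD; first by rewrite subn0 subrr /tail_sum big_geq.
rewrite tail_sumS ?phi_mirror ?subnSK //; last by lia.
by rewrite IHa ?[E a]tail_sumS //; [rewrite opprD addrCA addNKr|lia].
Qed.

Lemma tail_sum_mirror a b : (a <= D)%N -> (b <= D)%N ->
  E (D - b)%N - E (D - a)%N = E a - E b.
Proof.
by move=> aD bD; rewrite !tail_sum_opp // opprB addrC addrA subrK.
Qed.

End TailSums.

Definition swap_next (k j : nat) : nat :=
  if j == k then k.+1 else if j == k.+1 then k else j.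

(** The word lists each simple root once, and all pairs a < b are roots. *)
Lemma exponents_typeA :
  (forall i j : 'I_n, cartan_int form (tnth Pi (s i)) (tnth Pi (s j))
    = (cartan_entry (TypeA n) i j)%:~R) -> exponent_formula Phi Pi I.
Proof.
move=> cartanE; have refl := reflection_simple cartanE.
apply: (@words_exponents R V form Phi n Pi s rootPhi basePi n id _
          (fun _ _ => true) swap_next _ _ _ I (fun=> n)) => //.
- by move=> k kn; exists k.
- move=> k j kn jn; rewrite refl // /= /swap_next.
  case: (eqVneq j k) => [->|jk].
    by rewrite eqxx [k.+1 == k]gtn_eqF // tail_sumB1N // subr_scale.
  rewrite eqSS (negPf jk) eq_sym.
  case: (eqVneq j.+1 k) => [jk1|jk1].
    by rewrite -jk1 [j == _]ltn_eqF // tail_sumB2 // ?subr_scale // jk1.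
  case: (eqVneq j k.+1) jn => [->|jk2] jn; last by rewrite tail_sumB1 // subr_scale.
  by rewrite tail_sumB2 // subr_scale addrC.
- move=> k a b kn ab _; rewrite /swap_next.
  by case: (eqVneq a k) => ?; case: (eqVneq a k.+1) => ?; case: (eqVneq b k) => ?;
    case: (eqVneq b k.+1) => ?; first [by left; lia | by right; lia].
- by move=> i j iN /= ij; split=> //; lia.
- by move=> a b ab _; exists a, b; split=> //; lia.
- by move=> i i' l ii' /= il; lia.
by move=> i j j' iN jj' /= j'n; apply: Or31; exists j, j'; split=> //; lia.
Qed.

(** The transposition of the k-th and (k+1)-st coordinate vectors, acting on the
    indices of the vectors and of their opposites; for k = n - 1 and D = 2n - 1, the
    change of sign of the last coordinate vector. *)
Definition swap_mirror (D k j : nat) : nat :=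
  if j == k then k.+1 else if j == k.+1 then k else
  if j == (D - k)%N then (D - k.+1)%N else if j == (D - k.+1)%N then (D - k)%N else j.

(** The simple roots in order, followed by their mirror image; the last simple root
    is doubled when D = 2n and not when D = 2n - 1. *)
Definition fold_word (D j : nat) : nat := if (j < n)%N then j else (D - j.+1)%N.

Local Ltac if_lia := repeat (let H := fresh in case: ifP => H); lia.

Variant swap_mirror_spec (D k j : nat) : nat -> Prop :=
  | SwapUp of j = k : swap_mirror_spec D k j k.+1
  | SwapDown of j = k.+1 : swap_mirror_spec D k j k
  | MirrorDown of j = (D - k)%N & (k.+1 < j)%N : swap_mirror_spec D k j (D - k.+1)
  | MirrorUp of j = (D - k.+1)%N & (k.+1 < j)%N : swap_mirror_spec D k j (D - k)
  | Fixed of j <> k & j <> k.+1 & j <> (D - k)%N & j <> (D - k.+1)%N :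
      swap_mirror_spec D k j j.

Lemma swap_mirrorP D k j : (k.*2 < D)%N -> swap_mirror_spec D k j (swap_mirror D k j).
Proof.
move=> kD; rewrite /swap_mirror.
do 2![case: eqP => [|?]; first by constructor].
do 2![case: eqP => [?|?]; first by constructor; lia].
by constructor.
Qed.

Lemma swap_mirror_le D k x : (k.*2 < D)%N -> (x <= D)%N -> (swap_mirror D k x <= D)%N.
Proof. by move=> kD xD; case: (swap_mirrorP x kD) => *; lia. Qed.

(** An adjacent transposition reverses the order of a pair of indices only when it
    swaps the two. *)
Lemma swap_mirror_lt D k a b :
  (k.*2 < D)%N -> (k.*2.+2 != D)%N -> (a < b <= D)%N ->
  (b = a.+1 /\ (a = k \/ a = (D - k.+1)%N)) \/
  (swap_mirror D k a < swap_mirror D k b <= D)%N.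
Proof.
move=> kD kk ab; case: (swap_mirrorP a kD); case: (swap_mirrorP b kD) => *;
  first [by right; lia|by left; lia].
Qed.

Lemma swap_mirror_mirror D k x : (k.*2 < D)%N -> (k.*2.+2 != D)%N -> (x <= D)%N ->
  swap_mirror D k (D - x)%N = (D - swap_mirror D k x)%N.
Proof.
by move=> kD kk xD; case: (swap_mirrorP x kD); case: (swap_mirrorP (D - x) kD) => *; lia.
Qed.

(** Here D = 2n - 1: the indices 0, .., n - 1 stand for the coordinate vectors and
    n, .., 2n - 1 for their opposites in reverse order, up to a translation.  Thus
    E i - E (D - i) is twice a coordinate vector, a long root, so all pairs are
    roots.  The long root ends layer i and is the sum of E i - E j and
    E i - E (D - j). *)
Lemma exponents_typeC : (1 < n)%N ->
  (forall i j : 'I_n, cartan_int form (tnth Pi (s i)) (tnth Pi (s j))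
    = (cartan_entry (TypeC n) i j)%:~R) -> exponent_formula Phi Pi I.
Proof.
move=> n_gt1 cartanE; have refl := reflection_simple cartanE.
pose D := (2 * n - 1)%N; pose phi := fold_word D.
have phi_lt j : (j < D)%N -> (phi j < n)%N by rewrite /phi /fold_word /D; if_lia.
have phi_mirror j : (j < D)%N -> phi (D - j.+1)%N = phi j.
  by rewrite /phi /fold_word /D; if_lia.
have mirror := tail_sum_mirror phi_mirror.
pose E := tail_sum Pi s D phi.
have layersE k a b : (k <= a)%N -> (a < b <= D)%N -> (k <= D - b)%N ->
    in_layers n E (fun i => D - i)%N k (E a - E b).
  move=> ka ab kb; case: (leqP (a + b) D) => abD.
    by exists a, b; split=> //; lia.
  by exists (D - b)%N, (D - a)%N; split; rewrite ?mirror //; lia.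
apply: (@words_exponents R V form Phi n Pi s rootPhi basePi D phi phi_lt
          (fun _ _ => true) (swap_mirror D) _ _ _ I (fun i => D - i)%N) => //.
- by move=> k kn; exists k; split=> //; rewrite /phi /fold_word ?kn /D; lia.
- move=> k.
  (* The first half of the word; the second half follows by symmetry. *)
  have low j : (k < n)%N -> (j < n)%N ->
      reflection form (simple Pi s k) (simple Pi s (phi j)) =
      E (swap_mirror D k j) - E (swap_mirror D k j.+1).
    move=> kn jn; rewrite refl ?phi_lt /D //; try lia.
    have phiE i : (i < n)%N -> phi i = i by rewrite /phi /fold_word => ->.
    have piE i i' : swap_mirror D k i = i' -> E (swap_mirror D k i) = E i' by move=> ->.
    rewrite phiE //; case: (eqVneq j k) => [->|jk].
      rewrite (piE k k.+1) 1?(piE k.+1 k) ?tail_sumB1N ?phiE //;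
        try by rewrite /swap_mirror /D; if_lia.
      by rewrite /= eqxx (_ : _ && _ = false) ?subr_scale; [|lia].
    case: (eqVneq j.+1 k) => [jk1|jk1].
      rewrite (piE j j) 1?(piE j.+1 j.+2) ?tail_sumB2 ?phiE //;
        try by rewrite /swap_mirror /D; if_lia.
      rewrite /= (_ : _ && _ = false) ?(negPf jk) ?jk1 ?eqxx ?subr_scale //; lia.
    case: (eqVneq j k.+1) => [jE|jk2].
      case: (eqVneq j n.-1) => [jn1|jn1].
        have phik : phi k.+2 = k by rewrite /phi /fold_word /D; if_lia.
        rewrite (piE j k) 1?(piE j.+1 k.+3) ?tail_sumB3 ?phik ?(phiE k) ?(phiE k.+1) //;
          try by rewrite /swap_mirror /D; if_lia.
        have -> : cartan_entry (TypeC n) j k = - 2.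
          by rewrite /= (_ : (j == n.-1) && (k == n.-2)) //; lia.
        by rewrite subr_scale jE [simple Pi s k.+1 + _]addrC.
      rewrite (piE j k) 1?(piE j.+1 k.+2) ?tail_sumB2 ?phiE //;
        try by rewrite /swap_mirror /D; if_lia.
      by rewrite /= (negPf jn1) (negPf jk) jE eqxx orbT subr_scale addrC.
    rewrite (piE j j) 1?(piE j.+1 j.+1) ?tail_sumB1 ?phiE //;
      try by rewrite /swap_mirror /D; if_lia.
    by rewrite /= (_ : _ && _ = false) ?(negPf jk) ?(eq_sym k) ?(negPf jk1)
      ?(negPf jk2) ?subr_scale //; lia.
  move=> j kn jD; case: (ltnP j n) => [jn|nj]; first exact: low.
  rewrite -[phi j](phi_mirror _ jD) low; try by rewrite /D in jD *; lia.
  have -> : (D - j.+1).+1 = (D - j)%N by lia.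
  rewrite !swap_mirror_mirror ?mirror ?swap_mirror_le //; rewrite /D in jD *; lia.
- move=> k a b kn ab _.
  have [|||[bE ak]|lt_ab] := @swap_mirror_lt D k a b; rewrite /D //; try lia.
    by left; split=> //; rewrite /phi /fold_word; move: ak; rewrite /D; if_lia.
  by right.
- by move=> i j iN /= ij; split=> //; lia.
- move=> a b ab _; have [|||i [j [iN ij ->]]] := layersE 0%N a b; try lia.
  by exists i, j; split.
- by move=> i iN; rewrite /phi /fold_word iN.
- by move=> i i' l ii' /=; rewrite /phi /fold_word /D; if_lia.
move=> i j j' iN jj' /= j't.
case: (eqVneq j' (D - i)%N) => [j'E|ne_j'].
  apply: Or33; exists (D - j)%N; split; first by lia.
  - rewrite -[E i - E (D - j)%N](mirror i (D - j)%N); try lia.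
    rewrite subKn ?j'E; last by lia.
    by rewrite addrA subrK.
  by case: (leqP j (D - j)) => [jDj|jDj]; [left|right]; apply: layersE;
    rewrite /D in jDj *; lia.
by apply: Or31; apply: layersE; lia.
Qed.

(** In type B the index n stands for the zero vector, and the reflection in the short
    simple root exchanges its two neighbours. *)
Definition swap_short (k j : nat) : nat :=
  if k == n.-1 then
    if j == n.-1 then n.+1 else if j == n.+1 then n.-1 else j
  else swap_mirror (2 * n) k j.

Lemma swap_short_le k x : (k < n)%N -> (x <= 2 * n)%N -> (swap_short k x <= 2 * n)%N.
Proof.
move=> kn xn; rewrite /swap_short; case: ifP => _; last by rewrite swap_mirror_le //; lia.
by if_lia.
Qed.

Lemma swap_short_mirror k x : (k < n)%N -> (x <= 2 * n)%N ->
  swap_short k (2 * n - x) = (2 * n - swap_short k x)%N.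
Proof.
move=> kn xn; rewrite /swap_short; case: eqP => k1; first by if_lia.
by rewrite swap_mirror_mirror //; lia.
Qed.

(** Here D = 2n and E n is the centre: E i - E n is the short root, while
    E i - E (D - i), twice that root, is excluded.  In layer i the roots with indices
    j and D - j are separated by a short root, with E i - E n as midpoint. *)
Lemma exponents_typeB : (1 < n)%N ->
  (forall i j : 'I_n, cartan_int form (tnth Pi (s i)) (tnth Pi (s j))
    = (cartan_entry (TypeB n) i j)%:~R) -> exponent_formula Phi Pi I.
Proof.
move=> n_gt1 cartanE; have refl := reflection_simple cartanE.
pose D := (2 * n)%N; pose phi := fold_word D.
have phi_lt j : (j < D)%N -> (phi j < n)%N by rewrite /phi /fold_word /D; if_lia.
have phi_mirror j : (j < D)%N -> phi (D - j.+1)%N = phi j.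
  by rewrite /phi /fold_word /D; if_lia.
have mirror := tail_sum_mirror phi_mirror.
pose E := tail_sum Pi s D phi.
have layersE k a b : (k <= a)%N -> (a < b <= D)%N -> (k <= D - b)%N -> (a + b)%N != D ->
    in_layers n E (fun i => D - i.+1)%N k (E a - E b).
  move=> ka ab kb ne_ab; case: (ltnP (a + b) D) => abD.
    by exists a, b; split=> //; lia.
  by exists (D - b)%N, (D - a)%N; split; rewrite ?mirror //; lia.
apply: (@words_exponents R V form Phi n Pi s rootPhi basePi D phi phi_lt
          (fun a b => (a + b)%N != D) swap_short _ _ _ I (fun i => D - i.+1)%N) => //.
- by move=> k kn; exists k; split=> //; rewrite /phi /fold_word ?kn /D; lia.
- move=> k.
  (* The first half of the word; the second half follows by symmetry. *)
  have low j : (k < n)%N -> (j < n)%N ->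
      reflection form (simple Pi s k) (simple Pi s (phi j)) =
      E (swap_short k j) - E (swap_short k j.+1).
    move=> kn jn; rewrite refl ?phi_lt /D //; try lia.
    have phiE i : (i < n)%N -> phi i = i by rewrite /phi /fold_word => ->.
    have piE i i' : swap_short k i = i' -> E (swap_short k i) = E i' by move=> ->.
    rewrite phiE //; case: (eqVneq k n.-1) => [kE|kn1].
      case: (eqVneq j n.-1) => [jn1|jn1].
        have phin : phi n = k by rewrite /phi /fold_word /D; if_lia.
        rewrite (piE j n.+1) 1?(piE j.+1 n) ?tail_sumB1N ?phin //;
          try by rewrite /swap_short /swap_mirror /D; if_lia.
        rewrite jn1 -kE; have -> : cartan_entry (TypeB n) k k = 2.
          by rewrite /= eqxx (_ : _ && _ = false) //; lia.
        by rewrite subr_scale.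
      case: (eqVneq j n.-2) => [jn2|jn2].
        have phij : phi j.+2 = k by rewrite /phi /fold_word /D; if_lia.
        rewrite (piE j j) 1?(piE j.+1 j.+3) ?tail_sumB3 ?phij ?(phiE j) ?(phiE j.+1) //;
          try by rewrite /swap_short /swap_mirror /D; if_lia.
        have -> : cartan_entry (TypeB n) j k = - 2.
          by rewrite /= (_ : (j == n.-2) && (k == n.-1)) //; lia.
        by rewrite subr_scale (_ : j.+1 = k) //; lia.
      rewrite (piE j j) 1?(piE j.+1 j.+1) ?tail_sumB1 ?phiE //;
        try by rewrite /swap_short /swap_mirror /D; if_lia.
      have -> : cartan_entry (TypeB n) j k = 0.
        by rewrite /= (negPf jn2) /=; if_lia.
      by rewrite subr_scale.
    case: (eqVneq j k) => [->|jk].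
      rewrite (piE k k.+1) 1?(piE k.+1 k) ?tail_sumB1N ?phiE //;
        try by rewrite /swap_short /swap_mirror /D; if_lia.
      by rewrite /= (negPf kn1) andbF eqxx subr_scale.
    case: (eqVneq j.+1 k) => [jk1|jk1].
      rewrite (piE j j) 1?(piE j.+1 j.+2) ?tail_sumB2 ?phiE //;
        try by rewrite /swap_short /swap_mirror /D; if_lia.
      by rewrite /= (negPf kn1) andbF (negPf jk) jk1 eqxx subr_scale.
    case: (eqVneq j k.+1) => [jE|jk2].
      rewrite (piE j k) 1?(piE j.+1 k.+2) ?tail_sumB2 ?phiE //;
        try by rewrite /swap_short /swap_mirror /D; if_lia.
      by rewrite /= (negPf kn1) andbF (negPf jk) jE eqxx orbT subr_scale addrC.
    rewrite (piE j j) 1?(piE j.+1 j.+1) ?tail_sumB1 ?phiE //;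
      try by rewrite /swap_short /swap_mirror /D; if_lia.
    by rewrite /= (negPf kn1) andbF (negPf jk) (eq_sym k) (negPf jk1) (negPf jk2)
      subr_scale.
  move=> j kn jD; case: (ltnP j n) => [jn|nj]; first exact: low.
  rewrite -[phi j](phi_mirror _ jD) low; try by rewrite /D in jD *; lia.
  have -> : (D - j.+1).+1 = (D - j)%N by lia.
  rewrite !swap_short_mirror ?mirror ?swap_short_le //; rewrite /D in jD *; lia.
- move=> k a b kn ab ne_ab; rewrite /swap_short; case: eqP => [kE|kE].
    by rewrite /phi /fold_word /D in ab ne_ab *; if_lia.
  have kD : (k.*2 < 2 * n)%N by lia.
  have [|||[bE ak]|lt_ab] := @swap_mirror_lt D k a b; rewrite /D //; try lia.
    by left; split=> //; rewrite /phi /fold_word; move: ak; rewrite /D; if_lia.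
  right; split=> //; rewrite /D in ab ne_ab.
  by case: (swap_mirrorP a kD); case: (swap_mirrorP b kD) => *; lia.
- by move=> i j iN /= ij; split=> //; lia.
- move=> a b ab ne_ab; have [||||i [j [iN ij ->]]] := layersE 0%N a b; try lia.
  by exists i, j; split.
- by move=> i iN; rewrite /phi /fold_word iN.
- by move=> i i' l ii' /=; rewrite /phi /fold_word /D; if_lia.
move=> i j j' iN jj' /= j't.
case: (eqVneq (j + j')%N D) => [jjD|ne_jj].
  apply: Or32; exists n; split; first by lia.
  - rewrite -[E n - E j'](mirror n j'); try lia.
    by congr (E _ - E _); rewrite /D in jjD *; lia.
  by apply: layersE; rewrite /D in jjD *; lia.
by apply: Or31; apply: layersE; lia.
Qed.

End Classical.

(** * Computing Weyl-type subsets by adding roots one at a time *)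

(** A set of words of booleans, all of one length: a [Tip] is a word, and a [Fork]
    sorts words by their first letter.  The i-th letter tells whether the i-th root
    belongs to the subset encoded by the word. *)
Inductive trie := Dead | Tip | Fork of trie & trie.

Fixpoint accepts (t : trie) (w : seq bool) : bool :=
  match t, w with
  | Tip, [::] => true
  | Fork a b, c :: w' => accepts (if c then b else a) w'
  | _, _ => false
  end.

Fixpoint words (t : trie) : seq (seq bool) :=
  match t with
  | Dead => [::]
  | Tip => [:: [::]]
  | Fork a b => map (cons false) (words a) ++ map (cons true) (words b)
  end.

(** Appends a letter for a new root b to each word.  The role of a root x is
    [Some j] when b = x + y for the root y found j steps back along [path], the word
    read so far, in reverse.  Two members x, y forbid b to be out and two
    nonmembers forbid it to be in; [out] and [inn] are what remains allowed. *)
Fixpoint extend (roles : seq (option nat)) (t : trie) (path : seq bool)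
    (out inn : bool) {struct t} : trie :=
  match t, roles with
  | Tip, _ => Fork (if out then Tip else Dead) (if inn then Tip else Dead)
  | Fork a b, Some j :: roles' =>
      if nth false path j then
        Fork (extend roles' a (false :: path) out inn)
             (extend roles' b (true :: path) false inn)
      else
        Fork (extend roles' a (false :: path) out false)
             (extend roles' b (true :: path) out inn)
  | Fork a b, None :: roles' =>
      Fork (extend roles' a (false :: path) out inn)
           (extend roles' b (true :: path) out inn)
  | _, _ => Dead
  end.

(** Words are counted by their number of true letters; those of the right subtree
    have one more, so they are counted into the tail of the histogram. *)
Fixpoint tally (t : trie) (r : seq nat) : seq nat :=
  match t with
  | Dead => r
  | Tip => if r is c :: r' then c.+1 :: r' else [:: 1%N]
  | Fork a b =>
      if tally a r is c :: r' then c :: tally b r' else 0%N :: tally b [::]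
  end.

Fixpoint add_coefs (p q : seq nat) : seq nat :=
  match p, q with
  | a :: p', b :: q' => (a + b)%N :: add_coefs p' q'
  | [::], _ => q
  | _, [::] => p
  end.

(** Multiplication by 1 + X + .. + X ^ m in Horner form. *)
Definition mul_qint (m : nat) (p : seq nat) : seq nat :=
  iter m (fun q => add_coefs p (0%N :: q)) p.

(** The images f i of the monomials are left free so that the same histogram can be
    evaluated at X ^ i and at X ^ (N - i). *)
Fixpoint eval_coefs (f : nat -> {poly int}) (p : seq nat) : {poly int} :=
  if p is c :: p' then c%:R * f 0%N + eval_coefs (fun i => f i.+1) p' else 0.

Definition pol (p : seq nat) : {poly int} := eval_coefs (fun i => 'X^i) p.

Definition reciprocal (N : nat) (p : seq nat) : seq nat :=
  rev (p ++ nseq (N.+1 - size p) 0%N).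

(** Coordinates of a root in the basis of simple roots. *)
Local Notation coefs := (seq nat).

Definition add_root (x y : coefs) : coefs := [seq p.1 + p.2 | p <- zip x y]%N.

Fixpoint partners (b : coefs) (seen s : seq coefs) : seq (option nat) :=
  if s is x :: s' then
    let j := find (fun y => add_root x y == b) seen in
    (if (j < size seen)%N then Some j else None) :: partners b (x :: seen) s'
  else [::].

(** The dual partition of the height counts, with a check that dualising again gives
    the height counts back. *)
Definition dual_parts (H : nat) (A : seq coefs) : option (seq nat) :=
  let lam := [seq count (fun a => sumn a == j) A | j <- iota 1 H] in
  let ms := [seq count (leq i) lam | i <- iota 1 (head 0%N lam)] in
  if lam == [seq count (leq j) ms | j <- iota 1 H] then Some ms else None.

(** Complementation is an involution of W(A), so it is enough to search for the sets
    that avoid the first root: the others are their complements, counted by the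
    reciprocal polynomial.  For the empty A there is nothing to complete. *)
Definition full_tally (N : nat) (t : trie) : seq nat :=
  let half := tally t [::] in
  if N is 0 then half else add_coefs half (reciprocal N half).

Definition exponents_match (H : nat) (A : seq coefs) (t : trie) : bool :=
  (size (tally t [::]) <= (size A).+1)%N &&
  (if dual_parts H A is Some ms
   then full_tally (size A) t == foldr mul_qint [:: 1%N] ms else false).

(** Visits all complements of ideals: each root of [rest] is left out or, when the
    roots that it covers have been kept, put in.  The first root put in only gets the
    letter false, in accordance with [full_tally]. *)
Fixpoint search (H : nat) (rest : seq (coefs * seq coefs)) (A : seq coefs)
    (t : trie) : bool :=
  if rest is (b, covered) :: rest' then
    search H rest' A t &&
    (if all (mem A) covered
     then search H rest' (rcons A b) (extend (partners b [::] A) t [::] true (~~ nilp A))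
     else true)
  else exponents_match H A t.

Definition unit_root (n k : nat) : coefs := mkseq (fun i => nat_of_bool (i == k)) n.

Definition with_covered (n : nat) (L : seq coefs) : seq (coefs * seq coefs) :=
  [seq (b, [seq a <- L | has (fun k => add_root a (unit_root n k) == b) (iota 0 n)])
     | b <- L].

Section Reflections.
Variables (n : nat) (entry : nat -> nat -> int).

Definition reflect_coef (k : nat) (x : coefs) : int :=
  (nth 0%N x k)%:Z -
  foldr (fun i c => (nth 0%N x i)%:Z * entry i k + c) 0 (iota 0 n).

Definition reflect_root (k : nat) (x : coefs) : coefs :=
  if reflect_coef k x is Posz m then set_nth 0%N x k m else [::].

(** The candidate list of positive roots; its adequacy is not argued but tested by
    [positive_system]. *)
Definition reflection_closure (h : nat) : seq coefs :=
  let grow L := undup (L ++ [seq y <- [seq reflect_root k x | x <- L, k <- iota 0 n]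
                                | y != [::]]) in
  sort (fun x y => sumn x <= sumn y)%N
    (iter h grow [seq unit_root n k | k <- iota 0 n]).

Definition positive_system (H : nat) (L : seq coefs) : bool :=
  [&& uniq L, sorted (fun x y => sumn x <= sumn y)%N L,
      all (fun x => (size x == n) && (0 < sumn x <= H)%N) L,
      all (fun k => unit_root n k \in L) (iota 0 n)
    & all (fun x => all (fun k => (x == unit_root n k) || (reflect_root k x \in L))
                        (iota 0 n)) L].

Definition certified (H : nat) : bool :=
  let L := reflection_closure H in
  positive_system H L && search H (with_covered n L) [::] Tip.

End Reflections.

(** * Correctness of the trie operations *)

Lemma mem_words t w : (w \in words t) = accepts t w.
Proof.
elim: t w => [//||a IHa b IHb] w; first by case: w.
case: w => [|c w] /=; rewrite mem_cat.
  by apply/negP => /orP[] /mapP[].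
have cons_inj (d e : bool) l : (e :: w \in map (cons d) l) = (e == d) && (w \in l).
  elim: l => [|v l IHl] /=; first by rewrite andbF.
  by rewrite !inE IHl eqseq_cons; case: (e == d).
by rewrite !cons_inj IHa IHb; case: c; rewrite //= orbF.
Qed.

Lemma words_uniq t : uniq (words t).
Proof.
elim: t => [//|//|a IHa b IHb] /=; rewrite cat_uniq !map_inj_uniq ?IHa ?IHb //=.
  by rewrite andbT; apply/hasPn => _ /mapP[w _ ->]; apply/negP => /mapP[].
all: by move=> ? ? [].
Qed.

Lemma eval_coefs_add f p q :
  eval_coefs f (add_coefs p q) = eval_coefs f p + eval_coefs f q.
Proof.
elim: p q f => [|a p IHp] [|b q] f /=; rewrite ?add0r ?addr0 //.
by rewrite IHp natrD; ring.
Qed.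

Lemma eq_eval_coefs f g p : f =1 g -> eval_coefs f p = eval_coefs g p.
Proof. by elim: p f g => [//|c p IHp] f g fg /=; rewrite fg (IHp _ (g \o S)). Qed.

Lemma eval_coefs_mull c f p : eval_coefs (fun i => c * f i) p = c * eval_coefs f p.
Proof.
by elim: p f => [|a p IHp] f /=; [rewrite mulr0|rewrite (IHp (f \o S)) /=; ring].
Qed.

Lemma eval_coefsE f p : eval_coefs f p = \sum_(0 <= i < size p) (nth 0%N p i)%:R * f i.
Proof.
elim: p f => [|c p IHp] f /=; first by rewrite big_geq.
by rewrite big_nat_recl // IHp.
Qed.

Lemma eval_coefs_pad f p m : eval_coefs f (p ++ nseq m 0%N) = eval_coefs f p.
Proof.
elim: p f => [|c p IHp] f /=; last by rewrite IHp.
by elim: m f => [//|m IHm] f /=; rewrite IHm mul0r addr0.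
Qed.

Lemma pol_add p q : pol (add_coefs p q) = pol p + pol q.
Proof. exact: eval_coefs_add. Qed.

Lemma pol_cons0 p : pol (0%N :: p) = 'X * pol p.
Proof.
rewrite /pol /= mul0r add0r -eval_coefs_mull.
by apply: eq_eval_coefs => i; rewrite exprS.
Qed.

Lemma pol_reciprocal N p : (size p <= N.+1)%N ->
  pol (reciprocal N p) = eval_coefs (fun i => 'X^(N - i)) p.
Proof.
move=> sz; rewrite -(eval_coefs_pad _ p (N.+1 - size p)) /reciprocal.
set q := p ++ _; have szq : size q = N.+1 by rewrite size_cat size_nseq subnKC.
rewrite /pol !eval_coefsE size_rev szq [RHS]big_nat_rev.
apply: eq_big_nat => i /andP[_ iN]; rewrite nth_rev ?szq // add0n subSS.
by congr (_ * 'X^_); lia.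
Qed.

Lemma qintS m : qint m.+1 = 1 + 'X * qint m.
Proof.
rewrite /qint big_nat_recl // expr0 big_distrr /=; congr (_ + _).
by apply: eq_bigr => i _; rewrite exprS.
Qed.

Lemma pol_mul_qint m p : pol (mul_qint m p) = qint m * pol p.
Proof.
rewrite /mul_qint; elim: m => [|m IHm]; first by rewrite qint0 mul1r.
by rewrite iterS pol_add pol_cons0 IHm qintS; ring.
Qed.

Lemma eval_tally f t r : eval_coefs f (tally t r) =
  eval_coefs f r + \sum_(w <- words t) f (count id w).
Proof.
elim: t r f => [r|r|a IHa b IHb r] f /=.
- by rewrite big_nil addr0.
- rewrite big_seq1; case: r => [|c r] /=; first by ring.
  by rewrite -add1n natrD; ring.
rewrite big_cat !big_map /=.
rewrite [X in _ + (_ + X)](eq_bigr (fun w => f (count id w).+1)); last first.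
  by move=> w _; rewrite add1n.
have := IHa r f; case: (tally a r) => [|c r'] /= aE; rewrite IHb /= [RHS]addrA -aE.
  by ring.
by ring.
Qed.

(** What [extend] allows for the last letter after the word w. *)
Fixpoint flags (roles : seq (option nat)) (path w : seq bool) (out inn : bool) :=
  match roles, w with
  | Some j :: roles', c :: w' =>
      let p := nth false path j in
      flags roles' (c :: path) w' (out && ~~ (p && c)) (inn && ~~ (~~ p && ~~ c))
  | None :: roles', c :: w' => flags roles' (c :: path) w' out inn
  | _, _ => (out, inn)
  end.

Lemma accepts_extend roles t path w c out inn : size roles = size w ->
  accepts (extend roles t path out inn) (rcons w c) =
  accepts t w && (if c then (flags roles path w out inn).2
                  else (flags roles path w out inn).1).
Proof.
elim: w roles t path out inn => [|d w IHw] [|r roles] //= t path out inn; last first.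
  move=> [sz]; case: t => [|| a b] /=; first by case: r.
    by case: d; [case: inn|case: out] => //=; case: (w).
  case: r => [j|]; last by case: d; rewrite /= IHw.
  case: (nth false path j) => /=; case: d => /=; rewrite IHw //= ?andbT ?andbF //.
by case: t => [|| a b] //=; case: c; [case: inn|case: out].
Qed.

Lemma accepts_extend_rcons roles t path w out inn :
  accepts (extend roles t path out inn) w ->
  exists w' c, w = rcons w' c /\ accepts t w'.
Proof.
elim: t roles path w out inn =>
  [roles path w out inn|roles path w out inn|a IHa b IHb roles path w out inn] //=.
  case: w => [//|c [|? ?]] /=; first by exists [::], c.
  by case: c; [case: inn|case: out].
case: roles => [//|r roles].
have key o1 i1 o2 i2 : accepts (Fork (extend roles a (false :: path) o1 i1)
    (extend roles b (true :: path) o2 i2)) w ->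
    exists w' c, w = rcons w' c /\ accepts (Fork a b) w'.
  by case: w => [//|[] w] /= => [/IHb|/IHa] [w' [c [-> tw]]];
    [exists (true :: w'), c|exists (false :: w'), c].
by case: r => [j|]; [case: ifP => _|]; move=> /key.
Qed.

Section Clash.
Variables (b : coefs) (chi : coefs -> bool).

(** Decompositions of b are listed in the order in which [extend] meets them, each
    one at its later summand. *)
Fixpoint clash (c : bool) (seen s : seq coefs) : bool :=
  if s is x :: s' then
    (chi x == c) && has (fun y => (add_root x y == b) && (chi y == c)) seen
    || clash c (x :: seen) s'
  else false.

(** Cancellation makes the partner y of x unique, so that looking for the first one
    misses nothing. *)
Lemma flags_partners seen s out inn :
  {in seen ++ s & &, forall x y z,
     add_root x y == b -> add_root x z == b -> y = z} ->
  flags (partners b seen s) (map chi seen) (map chi s) out inn =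
  (out && ~~ clash true seen s, inn && ~~ clash false seen s).
Proof.
elim: s seen out inn => [|x s IHs] seen out inn cancel; first by rewrite /= !andbT.
have cancel' : {in (x :: seen) ++ s & &, forall x y z,
     add_root x y == b -> add_root x z == b -> y = z}.
  by move=> u v w uS vS wS; apply: cancel; move: uS vS wS; rewrite !(mem_cat, inE) -!orbA;
    do !case: eqP => //=; rewrite ?orbT.
rewrite [partners _ _ _]/=; set j := find _ _; case: ltnP => [j_lt|j_ge].
  have b_j : add_root x (nth [::] seen j) == b.
    by apply: (@nth_find _ [::] (fun y => add_root x y == b)); rewrite has_find.
  have has_j c : has (fun y => (add_root x y == b) && (chi y == c)) seen
      = (chi (nth [::] seen j) == c).
    apply/hasP/idP => [[y ys /andP[by_y cy]]|cj]; last first.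
      by exists (nth [::] seen j); rewrite ?mem_nth ?b_j.
    rewrite (_ : nth _ _ _ = y) //; apply: (cancel x) => //.
    - by rewrite mem_cat inE eqxx orbT.
    - by rewrite mem_cat mem_nth.
    by rewrite mem_cat ys.
  rewrite /= -/(map chi (x :: seen)) (nth_map [::]) // IHs // !has_j.
  by case: (chi x); case: (chi (nth _ _ _)); rewrite /= ?andbT ?andbF // -?andbA.
have no_j c : has (fun y => (add_root x y == b) && (chi y == c)) seen = false.
  apply/hasP => -[y ys /andP[by_y _]].
  by move: j_ge; rewrite leqNgt -has_find => /hasP; apply; exists y.
by rewrite /= -/(map chi (x :: seen)) IHs // !no_j !andbF.
Qed.

Lemma clashP c s :
  (forall x y, x \in s -> y \in s -> add_root x y = add_root y x) ->
  (forall x, x \in s -> add_root x x != b) ->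
  reflect (exists x y, [/\ x \in s, y \in s, chi x = c, chi y = c & add_root x y = b])
          (clash c [::] s).
Proof.
move=> addC add_neq.
have clash_seen seen s' : {subset seen ++ s' <= s} ->
    clash c seen s' <->
    exists x y, [/\ x \in s', y \in seen ++ s', chi x = c, chi y = c & add_root x y = b].
  elim: s' seen => [|x s' IHs] seen sub; first by split=> // -[x [y []]].
  have sub' : {subset (x :: seen) ++ s' <= s}.
    move=> u uS; apply: sub; move: uS; rewrite !(mem_cat, inE) -!orbA.
    by do !case: eqP => //=; rewrite ?orbT.
  rewrite /=; split.
    case/orP => [/andP[/eqP cx /hasP[y ys /andP[/eqP xy /eqP cy]]]|/(IHs _ sub')].
      by exists x, y; split; rewrite // ?mem_head // mem_cat ys.
    move=> [u [v [us vs cu cv uv]]]; exists u, v; split=> //.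
      by rewrite inE us orbT.
    by move: vs; rewrite !(mem_cat, inE) -!orbA; do !case: eqP => //=; rewrite ?orbT.
  move=> [u [v [us vs cu cv uv]]].
  have in_s w : w \in seen ++ x :: s' -> w \in s := sub w.
  case: (eqVneq u x) => [ux|ux].
    case: (boolP (v \in seen)) => [v_seen|v_seen].
      apply/orP; left; rewrite -ux cu eqxx /=; apply/hasP; exists v => //.
      by rewrite uv cv !eqxx.
    have vx : v != x.
      apply: contraNneq (add_neq x _) => [vx|]; last first.
        by apply: in_s; rewrite mem_cat inE eqxx orbT.
      by rewrite -{1}ux -vx uv.
    apply/orP; right; apply/IHs => //; exists v, u; split=> //.
    - by move: vs; rewrite mem_cat inE (negPf v_seen) (negPf vx).
    - by rewrite ux mem_cat mem_head.
    rewrite addC //; apply: in_s => //.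
    by rewrite ux mem_cat inE eqxx orbT.
  apply/orP; right; apply/IHs => //; exists u, v; split=> //.
    by move: us; rewrite inE (negPf ux).
  by move: vs; rewrite !(mem_cat, inE) -!orbA; do !case: eqP => //=; rewrite ?orbT.
by apply: (iffP idP) => /(clash_seen [::] s (fun x => id)).
Qed.

End Clash.

(** * Correctness of the search *)

Section AddOne.
Variables (R : archiRealFieldType) (V : vectType R).
Implicit Types (A S : {fset V}).

(** As beta is not a summand within the new set, the conditions involving it are those
    of the decompositions beta = x + y. *)
Lemma weyl_type_setsU1 A S (beta : V) :
  beta \notin A -> (forall z, z \in beta |` A -> beta + z \notin beta |` A) ->
  S `<=` beta |` A ->
  (S \in weyl_type_sets (beta |` A)) <->
  S `\ beta \in weyl_type_sets A /\
  forall x y, x \in A -> y \in A -> (x \in S) = (beta \notin S) ->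
    (y \in S) = (beta \notin S) -> x + y <> beta.
Proof.
move=> bA b_max SbA.
have neq_b x : x \in A -> (x == beta) = false.
  by move=> xA; apply: contraNF bA => /eqP <-.
split=> [/weyl_typeP[_ clS clC]|[/weyl_typeP[_ clS clC] no_split]].
  split; last first.
    move=> x y xA yA xS yS xy; have xyI : x + y \in beta |` A by rewrite xy !inE eqxx.
    case: (boolP (beta \in S)) xS yS => bS /= xS yS.
      have : x + y \notin S by apply: clC; rewrite ?xS ?yS // inE ?xA ?yA orbT.
      by rewrite xy bS.
    by move: bS; rewrite -xy clS.
  apply/weyl_typeP; split.
  - apply/fsubsetP => x; rewrite !inE => /andP[xb xS].
    by have := fsubsetP SbA x xS; rewrite !inE (negPf xb).
  - move=> x y; rewrite !inE => /andP[_ xS] /andP[_ yS] xyA.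
    by rewrite neq_b //=; apply: clS => //; rewrite !inE xyA orbT.
  move=> x y xA yA; rewrite !inE (neq_b x) // (neq_b y) //= => xS yS xyA.
  by rewrite negb_and orbC clC // !inE ?xA ?yA ?xyA orbT.
have inSb x : x \in A -> (x \in S `\ beta) = (x \in S).
  by move=> xA; rewrite !inE neq_b.
have not_b u v : u \in beta |` A -> v \in beta |` A -> u + v \in beta |` A ->
    u != beta /\ v != beta.
  move=> uI vI uvI; split; apply: contraTneq uvI => ->; first exact: b_max.
  by rewrite addrC; exact: b_max.
apply/weyl_typeP; split=> // x y.
  move=> xS yS xyI; have xI := fsubsetP SbA x xS; have yI := fsubsetP SbA y yS.
  have [xb yb] := not_b x y xI yI xyI.
  move: xyI; rewrite in_fset1U => /orP[/eqP xyb|xyA]; last first.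
    by rewrite -inSb // clS // !inE ?xb ?yb.
  rewrite xyb; apply: contraT => bS; case: (no_split x y) => //.
  - by move: xI; rewrite !inE (negPf xb).
  - by move: yI; rewrite !inE (negPf yb).
  - by rewrite xS bS.
  by rewrite yS bS.
move=> xI yI xS yS xyI; have [xb yb] := not_b x y xI yI xyI.
have xA : x \in A by move: xI; rewrite !inE (negPf xb).
have yA : y \in A by move: yI; rewrite !inE (negPf yb).
move: xyI; rewrite in_fset1U => /orP[/eqP xyb|xyA]; first last.
  by rewrite -inSb // clC // inSb.
rewrite xyb; apply/negP => bS; apply: (no_split x y) => //.
  by rewrite (negPf xS) bS.
by rewrite (negPf yS) bS.
Qed.

End AddOne.

Section CertifiedSystem.
Variables (R : archiRealFieldType) (V : vectType R) (form : {dot V for idfun}).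
Variables (Phi : {fset V}) (n : nat) (Pi : n.-tuple V) (s : 'S_n) (I : {fset V}).
Hypothesis rootPhi : root_system form Phi.
Hypothesis basePi : root_base Phi Pi.
Hypothesis idealI : root_ideal (pos_roots Phi Pi) I.
Variable entry : nat -> nat -> int.
Hypothesis cartanE : forall i j : 'I_n,
  cartan_int form (tnth Pi (s i)) (tnth Pi (s j)) = (entry i j)%:~R.
Local Notation P := (pos_roots Phi Pi).
Local Notation Ic := (P `\` I).

Definition vec (x : coefs) : V := \sum_(k < n) simple Pi s k *+ nth 0%N x k.

Lemma scoord_vec k x : (k < n)%N -> scoord Pi s k (vec x) = (nth 0%N x k)%:R.
Proof.
move=> kn; rewrite /vec.
rewrite (big_morph (scoord Pi s k) (scoordD Pi s k) (id1 := 0)); last first.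
  by rewrite /scoord; case: insub => //= j; rewrite linear0.
have scoordMn m v : scoord Pi s k (v *+ m) = scoord Pi s k v *+ m.
  elim: m => [|m IHm]; last by rewrite !mulrS scoordD IHm.
  by rewrite !mulr0n /scoord; case: insub => //= j; rewrite linear0.
rewrite (bigD1 (Ordinal kn)) //= scoordMn (scoord_simple s basePi) // eqxx.
rewrite big1 ?addr0 // => i ik; rewrite scoordMn (scoord_simple s basePi) //.
case: eqP => [ki|_]; last by rewrite mul0rn.
by case/eqP: ik; apply: val_inj.
Qed.

Lemma vec_inj x y : size x = n -> size y = n -> vec x = vec y -> x = y.
Proof.
move=> sx sy xy; apply: (@eq_from_nth _ 0%N) => [|k]; first by rewrite sx.
rewrite sx => kn; apply: (@natr_inj_R R).
by rewrite -!scoord_vec // xy.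
Qed.

Lemma size_add_root x y : size x = n -> size y = n -> size (add_root x y) = n.
Proof. by move=> sx sy; rewrite size_map size_zip sx sy minnn. Qed.

Lemma vec_add x y : size x = n -> size y = n -> vec (add_root x y) = vec x + vec y.
Proof.
move=> sx sy; rewrite /vec -big_split; apply: eq_bigr => k _ /=.
rewrite -mulrnDr (nth_map (0, 0)%N) ?size_zip ?sx ?sy ?minnn //.
by rewrite nth_zip ?sx ?sy.
Qed.

Lemma add_root_eq x y z : size x = n -> size y = n -> size z = n ->
  (add_root x y == z) = (vec x + vec y == vec z).
Proof.
move=> sx sy sz; rewrite -vec_add //; apply/eqP/eqP => [-> //|].
by apply: vec_inj; rewrite ?size_add_root.
Qed.

Lemma height_vec x : size x = n -> height Pi (vec x) = (sumn x)%:R.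
Proof.
move=> sx; rewrite /height (reindex_inj (@perm_inj _ s)) /=.
rewrite (eq_bigr (fun k : 'I_n => (nth 0%N x k)%:R)) => [|k _]; last first.
  by rewrite -scoordE scoord_vec.
by rewrite -natr_sum sumnE (big_nth 0%N) sx big_mkord.
Qed.

Lemma vec_unit k : (k < n)%N -> vec (unit_root n k) = simple Pi s k.
Proof.
move=> kn; rewrite /vec (bigD1 (Ordinal kn)) //= nth_mkseq // eqxx mulr1n.
rewrite big1 ?addr0 // => i ik; rewrite nth_mkseq // (_ : (_ == _) = false) //.
by apply/negbTE; apply: contraNneq ik => ik; apply/eqP/val_inj.
Qed.

Lemma cartan_int_vec k x : (k < n)%N ->
  cartan_int form (vec x) (simple Pi s k) =
  (foldr (fun i c => (nth 0%N x i)%:Z * entry i k + c) 0 (iota 0 n))%:~R.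
Proof.
move=> kn; have -> : foldr (fun i c => (nth 0%N x i)%:Z * entry i k + c) 0 (iota 0 n)
    = \sum_(i < n) (nth 0%N x i)%:Z * entry i k.
  rewrite -(big_mkord xpredT (fun i => (nth 0%N x i)%:Z * entry i k)).
  by rewrite unlock /reducebig /index_iota subn0.
rewrite rmorph_sum /vec.
rewrite (big_morph (cartan_int form ^~ (simple Pi s k))
  (fun u v => cartan_intD form u v _) (id1 := 0)); last first.
  by rewrite -(scale0r (0 : V)) cartan_intZ mul0r.
apply: eq_bigr => i _; rewrite -scaler_nat cartan_intZ rmorphM /=.
congr (_ * _); by rewrite -[k]/(val (Ordinal kn)) !simpleE cartanE.
Qed.

Lemma vec_reflect k x : (k < n)%N -> size x = n -> reflect_root n entry k x != [::] ->
  vec (reflect_root n entry k x) = reflection form (simple Pi s k) (vec x).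
Proof.
move=> kn sx; rewrite /reflect_root.
case cE: (reflect_coef n entry k x) => [m|//] _.
rewrite /reflection cartan_int_vec // /vec (bigD1 (Ordinal kn)) //= nth_set_nth /= eqxx.
rewrite [in RHS](bigD1 (Ordinal kn)) //= [RHS]addrAC; congr (_ + _); last first.
  apply: eq_bigr => i ik; rewrite nth_set_nth /= (_ : (_ == _) = false) //.
  by apply/negbTE; apply: contraNneq ik => ik; apply/eqP/val_inj.
rewrite -!scaler_nat -scalerBl; congr (_ *: _).
have := congr1 (fun z : int => z%:~R : R) cE.
by rewrite /reflect_coef /= rmorphB /= -!pmulrn => <-.
Qed.

Variables (H : nat) (L : seq coefs).
Hypothesis systemL : positive_system n entry H L.

Lemma system_uniq : uniq L.
Proof. by case/and5P: systemL. Qed.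

Lemma system_root x : x \in L -> [/\ size x = n, (0 < sumn x)%N & (sumn x <= H)%N].
Proof.
by case/and5P: systemL => _ _ /allP sL _ _ /sL /andP[/eqP -> /andP[-> ->]].
Qed.

(** The tests of [positive_system] are the closure conditions of
    [pos_roots_of_reflection_closed]. *)
Lemma system_pos_roots v : v \in P <-> exists2 x, x \in L & v = vec x.
Proof.
have /and5P[_ _ _ /allP unitL /allP reflL] := systemL.
move: v; apply: (pos_roots_of_reflection_closed rootPhi basePi).
- move=> _ [x /system_root[sx x_gt0 _] ->]; split.
    apply/eqP => /(congr1 (height Pi)); rewrite height_vec //.
    rewrite /height big1 => [/eqP|i _]; last by rewrite linear0.
    by rewrite pnatr_eq0; lia.
  move=> i; have := @scoord_vec ((s^-1)%g i) x (ltn_ord _).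
  by rewrite scoordE permKV => ->; rewrite rpred_nat.
- move=> i; exists (unit_root n ((s^-1)%g i)).
    by apply: unitL; rewrite mem_iota add0n ltn_ord.
  by rewrite vec_unit // -tnth_simple.
move=> i _ [x xL ->]; rewrite (tnth_simple Pi s) => x_neq.
set k := (s^-1)%g i in x_neq *.
have := allP (reflL x xL) k; rewrite mem_iota add0n ltn_ord => /(_ isT) /orP[/eqP xE|rL].
  by case/eqP: x_neq; rewrite xE vec_unit.
have [sx _ _] := system_root xL; have [sr r_gt0 _] := system_root rL.
exists (reflect_root n entry k x) => //; rewrite vec_reflect //.
by apply: contraTneq r_gt0 => ->.
Qed.

Definition vset (A : seq coefs) : {fset V} := [fset v in map vec A].

Lemma mem_vset A v : (v \in vset A) = (v \in map vec A).
Proof. by rewrite in_fset. Qed.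

Definition indicator (A : seq coefs) (S : {fset V}) := [seq vec x \in S | x <- A].

Definition avoids_head (A : seq coefs) (S : {fset V}) : bool :=
  if A is a :: _ then vec a \notin S else true.

(** Words are tested only as indicators of subsets; the first clause makes every word
    in the trie the indicator of one. *)
Definition represents (A : seq coefs) (t : trie) : Prop :=
  (forall w, accepts t w -> size w = size A) /\
  forall S, S `<=` vset A ->
    accepts t (indicator A S) = (S \in weyl_type_sets (vset A)) && avoids_head A S.

Lemma represents_nil : represents [::] Tip.
Proof.
split=> [[]//|S]; have -> : vset [::] = fset0 by apply/fsetP => v; rewrite mem_vset.
by rewrite fsubset0 weyl_type_sets0 => /eqP ->; rewrite inE eqxx.
Qed.

Lemma size_partners b seen A : size (partners b seen A) = size A.
Proof. by elim: A seen => [//|x A IHA] seen /=; rewrite IHA. Qed.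

Lemma add_rootC x y : size x = n -> size y = n -> add_root x y = add_root y x.
Proof.
by move=> sx sy; apply: vec_inj; rewrite ?size_add_root // !vec_add // addrC.
Qed.

(** A root of maximal height is not a summand within the new set. *)
Lemma represents_extend A b t :
  uniq (rcons A b) ->
  {subset rcons A b <= L} -> (forall x, x \in A -> (sumn x <= sumn b)%N) ->
  represents A t ->
  represents (rcons A b) (extend (partners b [::] A) t [::] true (~~ nilp A)).
Proof.
move=> uA subL Ab [t_size tP].
have okA x : x \in rcons A b -> [/\ size x = n, (0 < sumn x)%N & (sumn x <= sumn b)%N].
  move=> xA; have [sx x_gt0 _] := system_root (subL x xA); split=> //.
  by move: xA; rewrite mem_rcons inE => /predU1P[->//|/Ab].
have bAb : b \in rcons A b by rewrite mem_rcons mem_head.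
have inA x : x \in A -> x \in rcons A b by move=> xA; rewrite mem_rcons inE xA orbT.
have sb : size b = n by case: (okA b bAb).
have sA x : x \in A -> size x = n by case/inA/okA.
have bA : vec b \notin vset A.
  rewrite mem_vset; apply/mapP => -[x xA bx]; move: uA; rewrite rcons_uniq.
  by rewrite (vec_inj sb (sA x xA) bx) xA.
have vsetE : vset (rcons A b) = vec b |` vset A.
  apply/fsetP => v; rewrite mem_vset map_rcons mem_rcons inE in_fset1U.
  by rewrite mem_vset.
split=> [w|S SA].
  move=> /accepts_extend_rcons[w' [c [-> /t_size szw]]].
  by rewrite !size_rcons szw.
rewrite /indicator map_rcons accepts_extend ?size_partners ?size_map //.
rewrite (@flags_partners b (fun x => vec x \in S) [::] A) /=; last first.
  move=> x y z xA yA zA; rewrite !add_root_eq ?sb ?sA // => /eqP xy /eqP xz.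
  by apply: vec_inj; rewrite ?sA //; apply: (addrI (vec x)); rewrite xy xz.
have chiE : [seq vec x \in S | x <- A] = indicator A (S `\ vec b).
  apply/eq_in_map => x xA; rewrite !inE (_ : vec x != vec b) //.
  by apply: contraNneq bA => <-; rewrite mem_vset map_f.
have SbA : S `\ vec b `<=` vset A.
  apply/fsubsetP => v; rewrite in_fsetD1 => /andP[vb vS].
  by move: (fsubsetP SA v vS); rewrite vsetE in_fset1U (negPf vb).
rewrite chiE tP // vsetE.
have b_max z : z \in vec b |` vset A -> vec b + z \notin vec b |` vset A.
  have low v : v \in vec b |` vset A -> exists2 x, x \in rcons A b & v = vec x.
    by rewrite -vsetE mem_vset => /mapP.
  move=> /low[x xA ->]; apply/negP => /low[y yA bxy].
  have [sx x_gt0 _] := okA x xA; have [sy _ yb] := okA y yA.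
  have := congr1 (height Pi) bxy; rewrite heightD !height_vec // -natrD.
  by move/natr_inj_R; lia.
have addC x y : x \in A -> y \in A -> add_root x y = add_root y x.
  by move=> xA yA; rewrite add_rootC ?sA.
have add_neq x : x \in A -> add_root x x != b.
  move=> xA; rewrite add_root_eq ?sb ?sA //; apply/eqP => xxb.
  have inPhi y : y \in rcons A b -> vec y \in Phi.
    move=> /subL yL; have : vec y \in P by apply/system_pos_roots; exists y.
    by case/pos_rootsP.
  have := root_reduced rootPhi (c := 2) (inPhi x (inA x xA)).
  rewrite scaler_nat mulr2n xxb; move=> /(_ (inPhi b bAb)).
  by case; lra.
have SbA' : S `<=` vec b |` vset A by rewrite -vsetE.
(* With b in, two nonmembers may clash; with b out, two members. *)
have SW_E : (S \in weyl_type_sets (vec b |` vset A)) =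
    (S `\ vec b \in weyl_type_sets (vset A))
    && ~~ clash b (fun x => vec x \in S) (vec b \notin S) [::] A.
  apply/idP/andP => [/(weyl_type_setsU1 bA b_max SbA')[SW no_split]|[SW noclash]].
    split=> //; apply/clashP => // -[x [y [xA yA cx cy xy]]].
    apply: (no_split (vec x) (vec y)); rewrite ?mem_vset ?map_f //.
    by rewrite -vec_add ?sA // xy.
  apply/weyl_type_setsU1 => //; split=> // u v.
  rewrite !mem_vset => /mapP[x xA ->] /mapP[y yA ->] xS yS xy.
  case/clashP: noclash => //; exists x, y; split=> //.
  by apply/eqP; rewrite add_root_eq ?sb ?sA // xy.
have headE : avoids_head (rcons A b) S =
    if nilp A then vec b \notin S else avoids_head A (S `\ vec b).
  case: (A) bA => [//|a A'] bA'; rewrite /= !inE (_ : vec a != vec b) //.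
  by apply: contraNneq bA' => <-; rewrite mem_vset mem_head.
have head_nil : nilp A -> avoids_head A (S `\ vec b) by case: (A).
rewrite SW_E headE; case: (vec b \in S) => /=; case: nilp head_nil => /= [-> //|_];
  by rewrite ?andbT ?andbF // -!andbA; congr (_ && _); rewrite andbC.
Qed.

Lemma vec_inj_L x y : x \in L -> y \in L -> vec x = vec y -> x = y.
Proof.
by move=> /system_root[sx _ _] /system_root[sy _ _]; apply: vec_inj.
Qed.

Lemma card_vset A : uniq A -> {subset A <= L} -> #|` vset A| = size A.
Proof.
move=> uA AL; rewrite /vset card_fseq undup_id ?size_map // map_inj_in_uniq //.
by move=> x y /AL xL /AL yL; apply: vec_inj_L.
Qed.

Lemma sum_words f A t : uniq A -> {subset A <= L} -> represents A t ->
  \sum_(w <- words t) f (count id w) =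
  \sum_(S <- weyl_type_sets (vset A) | avoids_head A S) f #|` S| :> {poly int}.
Proof.
move=> uA AL [t_size tP].
have W_sub S : S \in weyl_type_sets (vset A) -> S `<=` vset A by case/weyl_typeP.
pose W := [seq T <- weyl_type_sets (vset A) | avoids_head A T].
have perm_words : perm_eq [seq indicator A T | T <- W] (words t).
  apply: uniq_perm => [||w]; [|exact: words_uniq|].
    rewrite map_inj_in_uniq ?filter_uniq ?fset_uniq // => S T.
    rewrite !mem_filter => /andP[_ /W_sub SA] /andP[_ /W_sub TA] /eq_in_map ST.
    apply/fsetP => v; have [vA|vA] := boolP (v \in vset A).
      by move: vA; rewrite mem_vset => /mapP[x xA ->]; apply: ST.
    by rewrite (contraNF (fsubsetP SA v)) // (contraNF (fsubsetP TA v)).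
  rewrite mem_words; apply/mapP/idP => [[S]|tw].
    by rewrite mem_filter => /andP[hS SW] ->; rewrite tP ?W_sub // SW hS.
  pose S := vset (mask w A).
  have wE : w = indicator A S.
    apply: (@eq_from_nth _ false) => [|i iw]; first by rewrite size_map t_size.
    have iA : (i < size A)%N by rewrite -(t_size w tw).
    rewrite (nth_map [::]) // mem_vset.
    have -> : vec (nth [::] A i) \in map vec (mask w A) = (nth [::] A i \in mask w A).
      apply/mapP/idP => [[x xm xE]|im]; last by exists (nth [::] A i).
      by rewrite (vec_inj_L _ _ xE) // AL // ?mem_nth // (mem_mask xm).
    by rewrite in_mask // mem_nth //= index_uniq.
  exists S => //; rewrite mem_filter andbC -tP -?wE //; apply/fsubsetP => v.
  by rewrite !mem_vset => /mapP[x /mem_mask xA ->]; apply: map_f.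
rewrite -(perm_big _ perm_words) big_map big_filter big_seq_cond [RHS]big_seq_cond.
apply: eq_bigr => S /andP[/W_sub SA _]; congr (f _).
rewrite /indicator count_map -size_filter -card_vset.
- congr #|` _|; apply/fsetP => v; rewrite mem_vset; apply/mapP/idP => [[x]|vS].
    by rewrite mem_filter => /andP[xS _] ->.
  have := fsubsetP SA v vS; rewrite mem_vset => /mapP[x xA vE].
  by exists x; rewrite // mem_filter /= -vE vS.
- by rewrite filter_uniq.
by move=> x; rewrite mem_filter => /andP[_ /AL].
Qed.

(** Sets containing the first root are complements of sets avoiding it. *)
Lemma represents_gf A t : uniq A -> {subset A <= L} -> represents A t ->
  (size (tally t [::]) <= (size A).+1)%N ->
  weyl_gf (vset A) = pol (full_tally (size A) t).
Proof.
move=> uA AL repA szt.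
have tallyE f : eval_coefs f (tally t [::]) =
    \sum_(S <- weyl_type_sets (vset A) | avoids_head A S) f #|` S|.
  by rewrite eval_tally add0r (sum_words f uA AL repA).
case: A => [|a A] in uA AL repA szt tallyE *; first by rewrite /full_tally /pol tallyE.
rewrite /full_tally [size _]/= pol_add pol_reciprocal // [pol _]tallyE tallyE.
rewrite /weyl_gf (bigID (avoids_head (a :: A))) /=; congr (_ + _).
have compl_perm : perm_eq
    [seq T <- weyl_type_sets (vset (a :: A)) | avoids_head (a :: A) T]
    [seq vset (a :: A) `\` T | T <- [seq T <- weyl_type_sets (vset (a :: A))
                                        | ~~ avoids_head (a :: A) T]].
  have aA : vec a \in vset (a :: A) by rewrite mem_vset mem_head.
  have W_sub S : S \in weyl_type_sets (vset (a :: A)) -> S `<=` vset (a :: A).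
    by case/weyl_typeP.
  apply: uniq_perm; first exact/filter_uniq/fset_uniq.
    rewrite map_inj_in_uniq; first exact/filter_uniq/fset_uniq.
    move=> S T; rewrite !mem_filter => /andP[_ /W_sub SA] /andP[_ /W_sub TA] ST.
    by rewrite -(fsetDK SA) ST fsetDK.
  move=> S; rewrite mem_filter; apply/andP/mapP => [[/= hS SW]|[T]].
    exists (vset (a :: A) `\` S); last by rewrite fsetDK ?W_sub.
    by rewrite mem_filter weyl_type_compl //= in_fsetD aA hS.
  rewrite mem_filter /= negbK => /andP[aT TW] ->.
  by rewrite weyl_type_compl // in_fsetD aT.
rewrite -[RHS]big_filter (perm_big _ compl_perm) big_map big_filter.
rewrite big_seq_cond [RHS]big_seq_cond; apply: eq_bigr => S /andP[/weyl_typeP[SA _ _] _].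
have := fsubset_leq_card SA; rewrite cardfsDS // card_vset // => le_S.
by rewrite subKn.
Qed.

Lemma pol_foldr_mul_qint ms : pol (foldr mul_qint [:: 1%N] ms) = \prod_(m <- ms) qint m.
Proof.
elim: ms => [|m ms IHms]; first by rewrite big_nil /pol /= expr0 mulr1 addr0.
by rewrite big_cons -IHms -pol_mul_qint.
Qed.

Lemma height_count_vset A j : uniq A -> {subset A <= L} ->
  height_count Pi (vset A) j = count (fun a => sumn a == j) A.
Proof.
move=> uA AL; rewrite -size_filter -card_vset.
- rewrite /height_count; congr #|` _|; apply/fsetP => v; rewrite mem_vset inE /=.
  have hE x : x \in A -> (height Pi (vec x) == j%:R) = (sumn x == j).
    by move=> /AL/system_root[sx _ _]; rewrite height_vec // eqr_nat.
  apply/andP/mapP => [[]|[x]].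
    rewrite mem_vset => /mapP[x xA ->]; rewrite hE // => xj.
    by exists x; rewrite // mem_filter xj.
  by rewrite mem_filter => /andP[xj xA] ->; rewrite hE // mem_vset map_f.
- by rewrite filter_uniq.
by move=> x; rewrite mem_filter => /andP[_ /AL].
Qed.

Lemma exponents_match_sound A t : uniq A -> {subset A <= L} -> vset A = Ic ->
  represents A t -> exponents_match H A t -> exponent_formula Phi Pi I.
Proof.
move=> uA AL AIc repA; rewrite /exponents_match /dual_parts; cbv zeta.
case/andP => szt.
pose lam := [seq count (fun a => sumn a == j) A | j <- iota 1 H].
pose ms := [seq count (leq i) lam | i <- iota 1 (head 0%N lam)].
rewrite -/lam -/ms.
case: eqP => // lamE /eqP tE; rewrite /exponent_formula -AIc /=.
rewrite (@prod_ideal_exponent _ _ _ Pi _ ms) => [|j j_gt0].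
  by rewrite -pol_foldr_mul_qint -tE; apply: represents_gf.
rewrite height_count_vset //; case: (leqP j H) => jH.
  have := congr1 (fun l => nth 0%N l j.-1) lamE.
  rewrite !(nth_map 0%N) ?size_iota ?nth_iota; try lia.
  by rewrite add1n prednK.
rewrite (@eq_in_count _ _ pred0) ?count_pred0 => [|x xA]; last first.
  by have [_ _ xH] := system_root (AL x xA); apply/eqP => /=; lia.
apply/esym/eqP; rewrite -leqn0 leqNgt -has_count; apply/hasPn => _ /mapP[i _ ->].
rewrite -ltnNge (leq_ltn_trans (count_size _ _)) // size_map size_iota; lia.
Qed.

(** Along the branch that keeps exactly the roots outside I, the test on covered roots
    never fails: a root covered by a root outside I is outside I, and has been
    visited because the list is sorted by height. *)
Lemma search_sound A r t :
  L = A ++ r ->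
  let kept := [seq a <- A | vec a \in Ic] in
  represents kept t ->
  search H
    [seq (b, [seq a <- L | has (fun k => add_root a (unit_root n k) == b) (iota 0 n)])
       | b <- r] kept t ->
  exponent_formula Phi Pi I.
Proof.
elim: r A t => [|b r IHr] A t LE /= repA.
  rewrite cats0 in LE; apply: exponents_match_sound repA.
  - by rewrite filter_uniq // -LE system_uniq.
  - by move=> x; rewrite mem_filter -LE => /andP[].
  apply/fsetP => v; rewrite mem_vset; apply/mapP/idP => [[x]|vIc].
    by rewrite mem_filter => /andP[xIc _] ->.
  have : v \in P by move: vIc; rewrite inE => /andP[].
  case/system_pos_roots => x xL vE; exists x => //.
  by rewrite mem_filter -vE vIc -LE.
case/andP => search_out search_in.
have LE' : L = rcons A b ++ r by rewrite cat_rcons.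
have bL : b \in L by rewrite LE mem_cat mem_head orbT.
case: (boolP (vec b \in Ic)) => bIc; last first.
  apply: (IHr (rcons A b) t) => //=; rewrite filter_rcons (negPf bIc) //.
have le_trans_sumn : transitive (fun x y : coefs => sumn x <= sumn y)%N.
  by move=> y x z /=; apply: leq_trans.
have := and5P systemL; case=> _ sortedL _ _ _.
move: (sortedL); rewrite sorted_pairwise // LE pairwise_cat.
case/and3P => /allrelP A_le _ /andP[/allP r_ge _].
have {}A_le a : a \in A -> (sumn a <= sumn b)%N.
  by move=> aA; apply: A_le; rewrite ?mem_head.
move: search_in; case: ifP => [_ search_in|/allP[]]; last first.
  move=> a; rewrite mem_filter => /andP[/hasP[k]].
  rewrite mem_iota add0n => kn /eqP ab aL.
  have [sa _ _] := system_root aL; have [sb _ _] := system_root bL.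
  have su : size (unit_root n k) = n by rewrite size_mkseq.
  have vE : vec b = vec a + simple Pi s k by rewrite -ab vec_add // vec_unit.
  have aIc : vec a \in Ic.
    apply: (coideal_summand idealI (b := simple Pi s k)); last by rewrite -vE.
      by apply/system_pos_roots; exists a.
    rewrite -[k]/(val (Ordinal kn)) simpleE; exact: (simple_pos_root basePi).
  have lt_ab : (sumn a < sumn b)%N.
    have := congr1 (height Pi) vE; rewrite heightD !height_vec //.
    by rewrite (height_simple_nat s basePi) // natr1 => /natr_inj_R ->.
  rewrite -[_ a]/(a \in [seq a <- A | vec a \in Ic]) mem_filter aIc /=.
  move: aL; rewrite LE mem_cat inE => /or3P[//|/eqP a_b|/r_ge] //.
    by rewrite a_b ltnn in lt_ab.
  by rewrite leqNgt lt_ab.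
apply: (IHr (rcons A b) _ LE'); rewrite filter_rcons bIc; last exact: search_in.
apply: represents_extend => //.
- have := system_uniq; rewrite LE' cat_uniq => /andP[uAb _].
  by have := filter_uniq (fun a => vec a \in Ic) uAb; rewrite filter_rcons bIc.
- move=> a; rewrite mem_rcons inE mem_filter => /predU1P[->//|/andP[_ aA]].
  by rewrite LE mem_cat aA.
by move=> a; rewrite mem_filter => /andP[_ /A_le].
Qed.

End CertifiedSystem.

Lemma certified_exponents (R : archiRealFieldType) (V : vectType R)
    (form : {dot V for idfun}) (Phi : {fset V}) (n : nat) (Pi : n.-tuple V)
    (s : 'S_n) (I : {fset V}) (entry : nat -> nat -> int) (H : nat) :
  root_system form Phi -> root_base Phi Pi -> root_ideal (pos_roots Phi Pi) I ->
  (forall i j : 'I_n,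
    cartan_int form (tnth Pi (s i)) (tnth Pi (s j)) = (entry i j)%:~R) ->
  certified n entry H -> exponent_formula Phi Pi I.
Proof.
move=> rootPhi basePi idealI cartanE /andP[systemL searchL].
apply: (search_sound rootPhi basePi idealI cartanE systemL (A := [::]) _ _ searchL) => //.
exact: represents_nil.
Qed.

(** Here 5 and 11 are the heights of the highest roots. *)
Lemma certified_G2 : certified 2 (cartan_entry TypeG2) 5.
Proof. by vm_compute. Qed.

Lemma certified_F4 : certified 4 (cartan_entry TypeF4) 11.
Proof. by vm_compute. Qed.

Lemma certified_E6 : certified 6 (cartan_entry TypeE6) 11.
Proof. by vm_compute. Qed.

Theorem theorem4p1 (R : archiRealFieldType) (V : vectType R)
    (form : {dot V for idfun}) (Phi : {fset V}) (n : nat) (Pi : n.-tuple V)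
    (X : cartan_type) (I : {fset V}) :
  root_system form Phi -> root_base Phi Pi ->
  admissible X -> has_cartan_type form Pi X ->
  root_ideal (pos_roots Phi Pi) I ->
  let Ic := pos_roots Phi Pi `\` I in
  let k := height_count Pi Ic 1 in
  \sum_(S <- weyl_type_sets Ic) 'X^(#|` S|) =
  \prod_(1 <= i < k.+1) \sum_(0 <= e < (ideal_exponent Pi Ic i).+1) 'X^e
    :> {poly int}.
Proof.
move=> rootPhi basePi admX [nX [s cartanE]] idealI.
rewrite -/(exponent_formula Phi Pi I).
case: X admX nX cartanE => [m|m|m|||] /= admX nX cartanE; subst n.
- exact: exponents_typeA cartanE.
- exact: exponents_typeB cartanE.
- exact: exponents_typeC cartanE.
- exact: (certified_exponents rootPhi basePi idealI cartanE certified_G2).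
- exact: (certified_exponents rootPhi basePi idealI cartanE certified_F4).
exact: (certified_exponents rootPhi basePi idealI cartanE certified_E6).
Qed.
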